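(* Let $F$ be a field, $d,l\geq1$ integers, and $\mathbf q=(q_1,\dots,q_l)\in F^l$. Then $$X_d^{\mathbf q}=\{\mathbf i^{\mathbf q}_{\lambda}\mid \lambda \text{ an } l\text{-multipartition of } d\}.$$
   Context: The degenerate affine Hecke algebra $H_d$ over $F$ is the $F$-algebra which equals $F[x_1,\dots,x_d]\otimes_F FS_d$ as a vector space, with multiplication such that $F[x_1,\dots,x_d]$ and $FS_d$ are subalgebras and $s_ix_{i+1}=x_is_i+1$, $s_ix_j=x_js_i$ for $j\ne i,i+1$, where $s_i=(i\ i{+}1)$. Its center $Z(H_d)$ consists of all symmetric polynomials in $x_1,\dots,x_d$. $H_d^{\mathbf q}$ is the quotient of $H_d$ by the two-sided ideal generated by $(x_1-q_1)\cdots(x_1-q_l)$; the quotient map sends $Z(H_d)$ onto $Z(H_d^{\mathbf q})$. For $\mathbf i=(i_1,\dots,i_d)\in F^d$, let $\chi(\mathbf i):Z(H_d)\to F$ be the homomorphism sending a symmetric polynomial $g(x_1,\dots,x_d)$ to $g(i_1,\dots,i_d)$. Write $\mathbf i\sim\mathbf j$ if $\mathbf j$ is obtained from $\mathbf i$ by permuting entries; $\chi(\mathbf i)=\chi(\mathbf j)$ iff $\mathbf i\sim\mathbf j$. Let $X_d$ be the set of $\sim$-equivalence classes in $F^d$ and $$X_d^{\mathbf q}=\{\mathbf i\in X_d\mid \chi(\mathbf i):Z(H_d)\to F\text{ factors through the quotient } Z(H_d^{\mathbf q})\}.$$ An $l$-multipartition of $d$ is a tuple $\lambda=(\lambda^{(1)},\dots,\lambda^{(l)})$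 of partitions with $\sum_r|\lambda^{(r)}|=d$. For a partition $\kappa$ and $q\in F$, the residue of the box in row $i$, column $j$ of the Young diagram of $\kappa$ is $q+j-i$, and $\mathbf i^q_\kappa$ is the tuple of all residues of boxes of $\kappa$, read in some order. Then $\mathbf i^{\mathbf q}_\lambda\in X_d$ is the class of the concatenation of $\mathbf i^{q_1}_{\lambda^{(1)}},\dots,\mathbf i^{q_l}_{\lambda^{(l)}}$. *)

(* Defs.v *)
From HB Require Import structures.
From mathcomp Require Import all_boot all_order all_fingroup all_algebra.
From mathcomp Require Import mpoly.

Set Implicit Arguments.
Unset Strict Implicit.
Unset Printing Implicit Defensive.

Import GRing.Theory.
Local Open Scope ring_scope.
Local Open Scope quotient_scope.

(* The degenerate affine Hecke algebra H_d, given by its defining property.   *)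
(* It determines H_d up to isomorphism: [dah_poly] and [dah_perm] embed F[x]  *)
(* and S_d, and [dah_basis] says that multiplication F[x] (x) F S_d -> H_d is *)
(* a linear isomorphism (F[x] (x) F S_d being the direct sum of the F[x] w).  *)
(* Permutations compose from left to right in MathComp; the opposite          *)
(* convention gives an isomorphic algebra, through w |-> w^-1.                *)
Record degAffHecke (F : fieldType) (d : nat) := DegAffHecke {
  dah_alg :> algType F;
  dah_poly : {lrmorphism {mpoly F[d]} -> dah_alg};
  dah_perm : 'S_d -> dah_alg;
  dah_perm1 : dah_perm 1%g = 1;
  dah_permM : {morph dah_perm : s t / (s * t)%g >-> s * t};
  dah_perm_X : forall i j : 'I_d, j = i.+1 :> nat ->
    dah_perm (tperm i j) * dah_poly 'X_j =
    dah_poly 'X_i * dah_perm (tperm i j) + 1;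
  dah_perm_X_far : forall i j k : 'I_d, j = i.+1 :> nat -> k != i -> k != j ->
    dah_perm (tperm i j) * dah_poly 'X_k =
    dah_poly 'X_k * dah_perm (tperm i j);
  dah_basis : bijective (fun f : {ffun 'S_d -> {mpoly F[d]}} =>
    \sum_(w : 'S_d) dah_poly (f w) * dah_perm w)
}.

Definition two_sided_ideal (A : pzRingType) (c z : A) : Prop :=
  exists s : seq (A * A), z = \sum_(p <- s) p.1 * c * p.2.

(* x_1 has index 0. *)
Definition cyclotomic_poly (F : fieldType) (d l : nat) (hd : (0 < d)%N)
    (q : l.-tuple F) : {mpoly F[d]} :=
  \prod_(r < l) ('X_(Ordinal hd) - (tnth q r)%:MP).

(* The F-algebra structure of the quotient is the one induced by [cq_proj];   *)
(* it is not bundled because MathComp's [algType] excludes the zero algebra.  *)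
Record cyclotomicQuotient (F : fieldType) (d l : nat) (H : degAffHecke F d)
    (hd : (0 < d)%N) (q : l.-tuple F) := CyclotomicQuotient {
  cq_ring :> pzRingType;
  cq_proj : {rmorphism H -> cq_ring};
  cq_proj_surj : forall y : cq_ring, exists z : H, cq_proj z = y;
  cq_proj_ker : forall z : H, cq_proj z = 0 <->
    two_sided_ideal (dah_poly H (cyclotomic_poly hd q)) z
}.

Definition central (A : pzRingType) (z : A) : Prop := forall y, z * y = y * z.

(* [chi i z c] is the graph of chi(i) : Z(H_d) -> F, g(x) |-> g(i). *)
Definition chi (F : fieldType) (d : nat) (H : degAffHecke F d)
    (i : d.-tuple F) (z : H) (c : F) : Prop :=
  exists2 g : {mpoly F[d]}, g \is symmetric
    & z = dah_poly H g /\ c = g.@[tnth i].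

(* F-algebra homomorphisms Z(H_d^q) -> F, as functions on H_d^q whose values  *)
(* outside the centre are irrelevant.                                         *)
Definition center_hom (F : fieldType) (d l : nat) (H : degAffHecke F d)
    (hd : (0 < d)%N) (q : l.-tuple F) (Hq : cyclotomicQuotient H hd q)
    (phi : Hq -> F) : Prop :=
  [/\ phi 1 = 1,
      forall y z : Hq, central y -> central z -> phi (y + z) = phi y + phi z,
      forall y z : Hq, central y -> central z -> phi (y * z) = phi y * phi z
    & forall (a : F) (z : Hq), central z -> phi (cq_proj Hq a%:A * z) = a * phi z].

Definition chi_factors (F : fieldType) (d l : nat) (H : degAffHecke F d)
    (hd : (0 < d)%N) (q : l.-tuple F) (Hq : cyclotomicQuotient H hd q)
    (i : d.-tuple F) : Prop :=
  exists2 phi : Hq -> F, center_hom phi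
    & forall z : H, central z -> chi i z (phi (cq_proj Hq z)).

Definition perm_tuple (F : eqType) (d : nat) : rel (d.-tuple F) :=
  fun i j => perm_eq i j.

Lemma perm_tuple_refl (F : eqType) (d : nat) : reflexive (@perm_tuple F d).
Proof. by move=> i; apply: perm_refl. Qed.

Lemma perm_tuple_sym (F : eqType) (d : nat) : ssrbool.symmetric (@perm_tuple F d).
Proof. by move=> i j; apply: perm_sym. Qed.

Lemma perm_tuple_trans (F : eqType) (d : nat) : transitive (@perm_tuple F d).
Proof. by move=> j i k; apply: perm_trans. Qed.

Canonical perm_tuple_equiv (F : eqType) (d : nat) :=
  EquivRel (@perm_tuple F d) (@perm_tuple_refl F d) (@perm_tuple_sym F d)
    (@perm_tuple_trans F d).

Notation Xd F d := {eq_quot (@perm_tuple F d)}.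

(* chi(i) only depends on the class of i, so any representative will do. *)
Definition Xdq (F : fieldType) (d l : nat) (H : degAffHecke F d)
    (hd : (0 < d)%N) (q : l.-tuple F) (Hq : cyclotomicQuotient H hd q)
    (c : Xd F d) : Prop :=
  chi_factors Hq (generic_quotient.repr c).

Definition is_partition (kappa : seq nat) : bool :=
  sorted geq kappa && (0%N \notin kappa).

Record multipartition (l d : nat) := Multipartition {
  mpart :> l.-tuple (seq nat);
  mpart_part : forall r : 'I_l, is_partition (tnth mpart r);
  mpart_size : (\sum_(r < l) sumn (tnth mpart r) = d)%N
}.

(* Rows and columns are numbered from 0, which does not change j - i. *)
Definition residues (F : fieldType) (q : F) (kappa : seq nat) : seq F :=
  [seq q + j%:R - i%:R | i <- iota 0 (size kappa), j <- iota 0 (nth 0%N kappa i)].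

Definition mresidues (F : fieldType) (l : nat) (q : l.-tuple F)
    (lam : l.-tuple (seq nat)) : seq F :=
  flatten [seq residues (tnth q r) (tnth lam r) | r <- enum 'I_l].

Lemma size_residues (F : fieldType) (q : F) (kappa : seq nat) :
  size (residues q kappa) = sumn kappa.
Proof.
rewrite size_allpairs_dep (eq_map (fun i => size_iota 0 (nth 0%N kappa i))).
by rewrite -/(mkseq _ _) mkseq_nth.
Qed.

Lemma size_mresidues (F : fieldType) (l d : nat) (q : l.-tuple F)
  (lam : multipartition l d) : size (mresidues q lam) == d.
Proof.
rewrite size_flatten /shape -map_comp sumnE big_map big_enum /=.
by under eq_bigr do rewrite size_residues; rewrite mpart_size.
Qed.

Definition residue_class (F : fieldType) (l d : nat) (q : l.-tuple F)
    (lam : multipartition l d) : Xd F d :=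
  \pi_(Xd F d) (Tuple (size_mresidues q lam)).

(* Main.v *)
From HB Require Import structures.
Require Import Defs.
From mathcomp Require Import all_boot all_order all_fingroup all_algebra.
From mathcomp Require Import mpoly.
From mathcomp Require Import zify ring.
From Stdlib Require Import Classical ClassicalEpsilon.

(** If chi(i) factors through Z(H_d^q), then Nakayama's lemma (H_d is finitely
    generated over the symmetric polynomials, which are its centre) gives a
    nonzero H_d^q-module on which the centre acts through i. Choose k maximal
    such that some nonzero vector generates, under S_k, a space on which x_1
    acts by q_1. By maximality the product of the x_{k+1} - q_r, r >= 2, kills
    all such vectors, so one can go on with q_2 and the remaining d - k
    variables. The S_k-module obtained for q_1 is treated in the same way: on
    the vectors invariant under S_m with m maximal, x_{m+1} acts by q_1 - 1, and
    one goes on with the next row. Blocks of invariance can be moved to the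
    front by conjugation, hence the row lengths decrease. This ends with a
    common eigenvector of x_1, ..., x_d whose eigenvalues are the residues of a
    multipartition.

    Conversely, let M' be the H_d-module induced from the permutation modules of
    tabloids of shape lambda^(r), on which x_1 acts by q_r. It is an
    H_d^q-module, and over S_d it is a permutation module on tabloids on which
    the signed sum over the column stabiliser of all the lambda^(r) together has
    rank one, as in James' proof of the submodule theorem; so Z(H_d^q) acts on
    the image by scalars. To find the scalars of the symmetric polynomials,
    compare M' with the module M induced from one-dimensional modules of the
    rows: it has the same underlying S_d-module, it is generated by a weight
    vector whose weights are the residues of lambda, and the x_j act in the same
    way on both copies of the module induced from the Specht modules of the
    lambda^(r), which contains the image. *)

Set Implicit Arguments.
Unset Strict Implicit.
Unset Printing Implicit Defensive.

Import GRing.Theory.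
Local Open Scope ring_scope.

(** * Induction on generators and divided differences *)

Lemma adjacent_perm_ind (d : nat) (Q : 'S_d -> Prop) :
  Q 1%g ->
  (forall (i j : 'I_d) (w : 'S_d), j = i.+1 :> nat ->
     Q w -> Q (tperm i j * w)%g) ->
  forall w, Q w.
Proof.
move=> Q1 QS.
have QT n : forall (i j : 'I_d) (w : 'S_d), j = (i + n.+1)%N :> nat -> Q w ->
    Q (tperm i j * w)%g.
  elim: n => [|n IHn] i j w ij Qw; first by apply: (QS); rewrite // ij addn1.
  have lt_jd : (j.-1 < d)%N by have := ltn_ord j; lia.
  pose j' := Ordinal lt_jd.
  have jj' : j = j'.+1 :> nat by rewrite /=; lia.
  have ij' : j' = (i + n.+1)%N :> nat by rewrite /=; lia.
  have -> : tperm i j = (tperm j' j * tperm i j' * tperm j' j)%g.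
    rewrite -{1}(tpermV j' j) -mulgA -conjgE tpermJ tpermL tpermD //.
    - by apply/eqP=> e; move: (congr1 val e) => /=; lia.
    - by apply/eqP=> e; move: (congr1 val e) => /=; lia.
  by rewrite -!mulgA; apply: (QS) => //; apply: IHn => //; apply: (QS).
have QA (i j : 'I_d) w : Q w -> Q (tperm i j * w)%g.
  move=> Qw; case: (ltngtP i j) => [lt|gt|/val_inj->].
  - by apply: (QT (j - i).-1) => //; lia.
  - by rewrite tpermC; apply: (QT (i - j).-1) => //; lia.
  - by rewrite tperm1 mul1g.
move=> w; have [ts -> _] := prod_tpermP w.
by elim: ts => [|t ts IH]; rewrite ?big_nil ?big_cons //; apply: QA.
Qed.

Lemma mpoly_alg_ind (d : nat) (R : comNzRingType) (Q : {mpoly R[d]} -> Prop) :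
  (forall c, Q c%:MP) -> (forall i, Q 'X_i) ->
  (forall p r, Q p -> Q r -> Q (p + r)) ->
  (forall p r, Q p -> Q r -> Q (p * r)) -> forall p, Q p.
Proof.
move=> QC QX QD QM; have QXm m : Q 'X_[m].
  rewrite mpolyXE_id; elim/big_ind: _ => [||i _]; [exact: (QC 1)|exact: QM|].
  elim: (m i) => [|n IHn]; first by rewrite expr0; exact: (QC 1).
  by rewrite exprS; apply: QM.
elim/mpolyind=> [|c m p _ _ Qp]; first by rewrite -mpolyC0.
by apply: QD => //; rewrite -mul_mpolyC; apply: QM.
Qed.

Lemma msymXi (d : nat) (R : nzRingType) (s : 'S_d) (i : 'I_d) :
  msym s ('X_i : {mpoly R[d]}) = 'X_(s i).
Proof. by rewrite /msym mmapX mmap1U. Qed.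

Lemma mpolyXB_neq0 (d : nat) (F : fieldType) (i j : 'I_d) :
  i != j -> 'X_j - 'X_i != 0 :> {mpoly F[d]}.
Proof.
move=> ij; apply/eqP => /(congr1 (mcoeff U_(j))); rewrite mcoeffB !mcoeffXU.
by rewrite eqxx (negPf ij) subr0 mcoeff0 => /eqP; rewrite oner_eq0.
Qed.

(* The polynomial [r] with [r * ('X_j - 'X_i) = p - s p] is the divided       *)
(* difference of [p]; it is unique, hence the same in every algebra [A].      *)
Lemma transposition_poly (F : fieldType) (d : nat) (A : nzRingType)
    (P : {rmorphism {mpoly F[d]} -> A}) (s : A) (i j : 'I_d) :
    i != j ->
    (forall c, s * P c%:MP = P c%:MP * s) ->
    s * P 'X_j = P 'X_i * s + 1 ->
    s * P 'X_i = P 'X_j * s - 1 ->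
    (forall k, k != i -> k != j -> s * P 'X_k = P 'X_k * s) ->
  forall p : {mpoly F[d]},
    (exists r, r * ('X_j - 'X_i) = p - msym (tperm i j) p) /\
    forall r, r * ('X_j - 'X_i) = p - msym (tperm i j) p ->
      s * P p = P (msym (tperm i j) p) * s + P r.
Proof.
move=> ij sC sXj sXi sX p.
suff [r rE sP] : exists2 r, r * ('X_j - 'X_i) = p - msym (tperm i j) p
    & s * P p = P (msym (tperm i j) p) * s + P r.
  split=> [|r']; first by exists r.
  by rewrite -rE => /(mulIf (mpolyXB_neq0 F ij)) ->.
elim/mpoly_alg_ind: p => [c|k|p r [p' p'E sp] [r' r'E sr]|
    p r [p' p'E sp] [r' r'E sr]].
- have -> : msym (tperm i j) c%:MP = c%:MP :> {mpoly F[d]}.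
    by rewrite /msym mmapC.
  by exists 0; rewrite ?mul0r ?subrr // rmorph0 addr0.
- rewrite msymXi; have [->|kj] := eqVneq k j.
    by exists 1; rewrite tpermR ?mul1r ?rmorph1.
  have [->|ki] := eqVneq k i.
    by exists (-1); rewrite tpermL ?mulN1r ?opprB // rmorphN rmorph1.
  by rewrite tpermD 1?eq_sym //; exists 0;
    rewrite ?mul0r ?subrr // rmorph0 addr0 sX.
- exists (p' + r'); first by rewrite mulrDl p'E r'E rmorphD opprD addrACA.
  by rewrite !rmorphD mulrDr sp sr mulrDl addrACA.
- exists (msym (tperm i j) p * r' + p' * r).
    rewrite mulrDl -(mulrA _ r') r'E mulrAC p'E rmorphM.
    by rewrite mulrBr mulrBl addrC addrA subrK.
  rewrite rmorphM mulrA sp mulrDl -mulrA sr mulrDr !rmorphM rmorphD !rmorphM.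
  by rewrite !mulrA addrA.
Qed.

Lemma transposition_flip (A : pzRingType) (s x y : A) :
  s * s = 1 -> s * y = x * s + 1 -> s * x = y * s - 1.
Proof.
move=> ss sy; rewrite -[LHS]mulr1 -{1}ss mulrA -(mulrA s).
have <- : s * y - 1 = x * s by rewrite sy addrK.
by rewrite mulrBr mulr1 mulrA ss mul1r mulrBl ss.
Qed.

(** * Normal forms and commutation rules in [H] *)

Section Hecke.

Variables (F : fieldType) (d : nat) (H : degAffHecke F d).

Local Notation P := (dah_poly H).
Local Notation T := (@dah_perm F d H).

Definition dah_comb (f : {ffun 'S_d -> {mpoly F[d]}}) : H :=
  \sum_(w : 'S_d) P (f w) * T w.

Lemma dah_combD f g : dah_comb (f + g) = dah_comb f + dah_comb g.
Proof.
rewrite /dah_comb -big_split; apply: eq_bigr => w _.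
by rewrite ffunE rmorphD mulrDl.
Qed.

Lemma dah_comb_inj : injective dah_comb.
Proof. exact: (bij_inj (dah_basis H)). Qed.

Lemma dah_comb_surj (z : H) : exists f, z = dah_comb f.
Proof. by case: (dah_basis H) => g _ gK; exists (g z); rewrite -[LHS]gK. Qed.

Definition dah_single (w : 'S_d) (p : {mpoly F[d]}) :
  {ffun 'S_d -> {mpoly F[d]}} := [ffun u => if u == w then p else 0].

Lemma dah_comb_single w p : dah_comb (dah_single w p) = P p * T w.
Proof.
rewrite /dah_comb (bigD1 w) //= ffunE eqxx big1 ?addr0 // => u /negPf uw.
by rewrite ffunE uw rmorph0 mul0r.
Qed.

Lemma dah_ind (Q : H -> Prop) :
  (forall z z', Q z -> Q z' -> Q (z + z')) -> (forall p w, Q (P p * T w)) ->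
  forall z, Q z.
Proof.
move=> QD Qb z; have [f ->] := dah_comb_surj z.
apply: big_ind => //; first by rewrite -(mul0r (T 1%g)) -(rmorph0 P); exact: Qb.
Qed.

Lemma dah_alg_ind (Q : H -> Prop) :
  (forall c, Q (P c%:MP)) -> (forall k, Q (P 'X_k)) -> (forall w, Q (T w)) ->
  (forall z z', Q z -> Q z' -> Q (z + z')) ->
  (forall z z', Q z -> Q z' -> Q (z * z')) -> forall z, Q z.
Proof.
move=> QC QX QT QD QM; apply: dah_ind => // p w; apply: (QM) => //.
elim/mpoly_alg_ind: p => // p r Qp Qr; first by rewrite rmorphD; apply: QD.
by rewrite rmorphM; apply: QM.
Qed.

Lemma dah_poly_inj : injective P.
Proof.
move=> p r pr; have /dah_comb_inj/ffunP/(_ 1%g) :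
    dah_comb (dah_single 1 p) = dah_comb (dah_single 1 r).
  by rewrite !dah_comb_single pr.
by rewrite !ffunE eqxx.
Qed.

Lemma dah_tpermK i j : T (tperm i j) * T (tperm i j) = 1.
Proof. by rewrite -dah_permM tperm2 dah_perm1. Qed.

Lemma dah_perm_X_inv (i j : 'I_d) : j = i.+1 :> nat ->
  T (tperm i j) * P 'X_i = P 'X_j * T (tperm i j) - 1.
Proof.
by move=> ij; apply: transposition_flip; rewrite ?dah_tpermK // dah_perm_X.
Qed.

Lemma dah_polyC (c : F) : P c%:MP = c%:A.
Proof. by rewrite -alg_mpolyC linearZ rmorph1. Qed.

Lemma dah_permC (c : F) w : T w * P c%:MP = P c%:MP * T w.
Proof.
by rewrite dah_polyC mulr_algl mulr_algr.
Qed.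

Lemma dah_tperm_poly (i j : 'I_d) (p : {mpoly F[d]}) : j = i.+1 :> nat ->
  (exists r, r * ('X_j - 'X_i) = p - msym (tperm i j) p) /\
  forall r, r * ('X_j - 'X_i) = p - msym (tperm i j) p ->
    T (tperm i j) * P p = P (msym (tperm i j) p) * T (tperm i j) + P r.
Proof.
move=> ij; apply: transposition_poly => [|c|||k ki kj].
- by apply/eqP => e; move: ij; rewrite e; lia.
- exact: dah_permC.
- exact: dah_perm_X.
- exact: dah_perm_X_inv.
- exact: dah_perm_X_far.
Qed.

(** The divided difference of a symmetric polynomial is 0, so it commutes with every simple
    reflection. *)
Lemma dah_sym_central (g : {mpoly F[d]}) : g \is symmetric -> central (P g).
Proof.
move=> /issymP gs; have gT w : P g * T w = T w * P g.
  elim/adjacent_perm_ind: w => [|i j w ij IH].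
    by rewrite dah_perm1 mulr1 mul1r.
  rewrite dah_permM mulrA -[RHS]mulrA -IH mulrA; congr (_ * _).
  have [_ /(_ 0)] := dah_tperm_poly g ij.
  by rewrite mul0r gs subrr rmorph0 addr0 => ->.
elim/dah_ind=> [z z' zE z'E|p w]; first by rewrite mulrDl mulrDr zE z'E.
by rewrite -[RHS]mulrA -gT !mulrA -!rmorphM mulrC.
Qed.

(* Group elements of lower order appear with constant coefficients. *)
Lemma dah_permX w (k : 'I_d) : exists a : {ffun 'S_d -> F},
  T w * P 'X_k = P 'X_((w^-1)%g k) * T w + \sum_u P (a u)%:MP * T u.
Proof.
elim/adjacent_perm_ind: w => [|i j w ij [a IH]].
  exists 0; rewrite invg1 perm1 dah_perm1 mulr1 mul1r big1 ?addr0 // => u _.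
  by rewrite ffunE mpolyC0 rmorph0 mul0r.
rewrite invMg tpermV permM; set m := (w^-1)%g k.
have [b bE] : exists b : F,
   T (tperm i j) * P 'X_m =
   P 'X_(tperm i j m) * T (tperm i j) + P b%:MP.
  have [->|mj] := eqVneq m j.
    by exists 1; rewrite tpermR mpolyC1 rmorph1; apply: dah_perm_X.
  have [->|mi] := eqVneq m i.
    exists (-1); rewrite tpermL mpolyCN mpolyC1 rmorphN rmorph1.
    exact: dah_perm_X_inv.
  exists 0; rewrite tpermD 1?eq_sym // mpolyC0 rmorph0 addr0.
  exact: dah_perm_X_far.
exists [ffun u => (if u == w then b else 0) + a (tperm i j * u)%g].
rewrite dah_permM -mulrA IH mulrDr mulrA bE mulrDl -!mulrA -dah_permM -addrA.
congr (_ + _); under [RHS]eq_bigr do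
  rewrite ffunE mpolyCD rmorphD mulrDl.
rewrite big_split /=; congr (_ + _).
  rewrite (bigD1 w) //= eqxx big1 ?addr0 // => u /negPf ->.
  by rewrite mpolyC0 rmorph0 mul0r.
rewrite (reindex_inj (mulgI (tperm i j))) /= mulr_sumr; apply: eq_bigr => u _.
by rewrite mulrA dah_permC -mulrA -dah_permM mulgA tperm2 mul1g.
Qed.

End Hecke.

(** * The centre *)

Section HeckeCenter.

Variables (F : fieldType) (d : nat) (H : degAffHecke F d).

Local Notation P := (dah_poly H).
Local Notation T := (@dah_perm F d H).

Lemma mul_dah_comb (p : {mpoly F[d]}) f :
  P p * dah_comb H f = dah_comb H [ffun w => p * f w].
Proof.
by rewrite mulr_sumr; apply: eq_bigr => w _; rewrite ffunE mulrA rmorphM.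
Qed.

(* Comparing total degrees: if [f w] has maximal degree among the [w != 1]    *)
(* and [w] moves [k], the commutator with ['X_k] has the coefficient          *)
(* [f w * ('X_(w^-1 k) - 'X_k)] at [w], up to terms of lower degree.          *)
Lemma central_dah_comb f : central (dah_comb H f) ->
  forall w, w != 1%g -> f w = 0.
Proof.
move=> fC w0 w01; apply/eqP; apply: contraT => fw0.
have [w w1 wmax] := @arg_maxnP _ w0 (fun w => w != 1%g) (fun w =>
  msize (f w)) w01.
have fw : f w != 0.
  by rewrite -msize_poly_eq0 -lt0n (leq_trans _ (wmax _ w01)) // lt0n
    msize_poly_eq0.
have [k wk] : exists k, (w^-1)%g k != k.
  apply/existsP; apply: contraNT w1 => /existsPn fix_w.
  rewrite -eq_invg1; apply/eqP/permP=> k; rewrite perm1; apply/eqP.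
  by move: (fix_w k); rewrite negbK.
(* Taking [a] to be 0 at the identity keeps [f 1] out of the error terms: its degree is not bounded
   by that of [f w]. *)
have /fin_all_exists[a aE] : forall u, exists b : {ffun 'S_d -> F},
    (T u * P 'X_k = P 'X_((u^-1)%g k) * T u + \sum_t P (b t)%:MP * T t)
    /\ (u = 1%g -> b = 0).
  move=> u; have [->|u1] := eqVneq u 1%g.
    exists 0; split=> //; rewrite invg1 perm1 dah_perm1 mulr1 mul1r.
    by rewrite big1 ?addr0 // => t _; rewrite ffunE mpolyC0 rmorph0 mul0r.
  by have [b bE] := dah_permX H u k; exists b; split=> // u1';
    rewrite u1' eqxx in u1.
have /dah_comb_inj/ffunP/(_ w) :
    dah_comb H [ffun u => f u * 'X_((u^-1)%g k) + \sum_t f t * (a t u)%:MP] =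
    dah_comb H [ffun u => 'X_k * f u].
  rewrite -mul_dah_comb -fC {2}/dah_comb mulr_suml.
  under [RHS]eq_bigr => u _ do
    rewrite -mulrA (aE u).1 mulrDr mulrA -rmorphM mulr_sumr.
  rewrite big_split /= exchange_big -big_split /=; apply: eq_bigr => u _.
  rewrite ffunE rmorphD mulrDl; congr (_ + _).
  rewrite rmorph_sum mulr_suml; apply: eq_bigr => t _.
  by rewrite rmorphM mulrA.
rewrite !ffunE [RHS]mulrC => /(canRL (addKr _)); rewrite addrC -mulrBr => Ef.
have : (msize (\sum_t f t * (a t w)%:MP) <= msize (f w))%N.
  apply: leq_trans (msize_sum _ _ _) _; apply/bigmax_leqP => t _.
  have [->|t1] := eqVneq t 1%g.
    by rewrite (aE 1%g).2 // ffunE mpolyC0 mulr0 mmeasure0.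
  by rewrite mulrC mul_mpolyC; apply: leq_trans (msizeZ_le _ _) (wmax _ t1).
rewrite Ef msizeM ?mpolyXB_neq0 //.
have : (1 < msize ('X_k - 'X_((w^-1)%g k) : {mpoly F[d]}))%N.
  have := @msize_mdeg_lt _ _ ('X_k - 'X_((w^-1)%g k) : {mpoly F[d]}) U_(k)%MM.
  rewrite mdeg1; apply; rewrite mcoeff_msupp mcoeffB !mcoeffXU eqxx.
  by rewrite (negPf wk) subr0 oner_eq0.
have key m n : m != 0%N -> (1 < n -> (m + n).-1 <= m -> false)%N by lia.
by move: fw; rewrite -msize_poly_eq0; apply: key.
Qed.

(** Once [central_dah_comb] leaves only a polynomial [g], compare the coefficients of a simple
    reflection [s] in the normal forms of [T s * P g] and [P g * T s]: the divided difference sits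
    at the identity, so [g] is invariant under [s]. *)
Lemma dah_centralP (z : H) :
  central z <-> exists2 g, g \is symmetric & z = P g.
Proof.
split=> [|[g gs ->]]; last exact: dah_sym_central.
have [f ->] := dah_comb_surj z => fC.
have fE : dah_comb H f = P (f 1%g).
  rewrite /dah_comb (bigD1 1%g) //= big1 ?addr0 ?dah_perm1 ?mulr1 // => w w1.
  by rewrite (central_dah_comb fC) // rmorph0 mul0r.
exists (f 1%g) => //; move: (f 1%g) fE fC => g -> gC; apply/issymP => w.
elim/adjacent_perm_ind: w g gC => [|i j w ij IH] g gC; first exact: msym1m.
rewrite msymMm; suff -> : msym (tperm i j) g = g by apply: IH.
have [[r rE] /(_ r rE)] := dah_tperm_poly H g ij.
rewrite -gC -[P r]mulr1 -(dah_perm1 H) -!dah_comb_single -dah_combD.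
move=> /dah_comb_inj/ffunP/(_ (tperm i j)); rewrite !ffunE eqxx.
have -> : tperm i j == 1%g = false; last by rewrite addr0.
apply/eqP => /permP/(_ i); rewrite tpermL perm1 => e.
by move: ij; rewrite e; lia.
Qed.

End HeckeCenter.

(** * Weights of modules over the cyclotomic quotient *)

Lemma ex_last (Q : nat -> Prop) N : Q 0%N -> ~ Q N -> exists k, Q k /\ ~ Q k.+1.
Proof.
elim: N => [//|N IHN] Q0 QN; have [QN'|/IHN] := classic (Q N); last exact.
by exists N.
Qed.

Lemma residues_cons (F : fieldType) (q : F) k kappa :
  residues q (k :: kappa) =
  [seq q + j%:R | j <- iota 0 k] ++ residues (q - 1) kappa.
Proof.
rewrite /residues /= -[1%N]/(1 + 0)%N iotaDl allpairs_mapl.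
congr (_ ++ _); first by apply: eq_map => j; rewrite subr0.
congr flatten; apply: eq_map => i /=; apply: eq_map => j.
by rewrite natrD opprD addrA (addrAC q j%:R) addrAC.
Qed.

Section HeckeModule.

Variables (F : fieldType) (d : nat) (H : degAffHecke F d.+1) (V : lmodType H).

(** Positions are natural numbers starting at 0, so that arithmetic on them is plain. The scalars of
    [V] form all of [H]; the field acts through [c%:A]. *)
Definition hx k : H := dah_poly H 'X_(inord k).
Definition ht i j : H := dah_perm H (tperm (inord i) (inord j)).
Definition hs k : H := ht k k.+1.

Implicit Types (u v : V) (W : V -> Prop).

Local Notation sc c v := ((c : F)%:A *: v).

Lemma scC c (h : H) (v : V) : h *: sc c v = sc c (h *: v).
Proof. by rewrite !scalerA mulr_algr mulr_algl. Qed.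

Lemma scB c c' (v : V) : sc c v - sc c' v = sc (c - c') v.
Proof. by rewrite -scalerBl -scalerBl. Qed.

Lemma sc_eq0 c (v : V) : sc c v = 0 -> v != 0 -> c = 0.
Proof.
move=> cv v0; apply/eqP; apply: contraNT v0 => c0.
rewrite -[v]scale1r -[1](scale1r (1 : H)) -(mulVf c0) -scalerA -[_ *: (_ *:
  _)]mulr_algl.
by rewrite -scalerA cv scaler0.
Qed.

Lemma hxC i j : hx i * hx j = hx j * hx i.
Proof. by rewrite /hx -!rmorphM mulrC. Qed.

Lemma htK i j : ht i j * ht i j = 1.
Proof. exact: dah_tpermK. Qed.

Lemma hsK k (v : V) : hs k *: (hs k *: v) = v.
Proof. by rewrite scalerA htK scale1r. Qed.

Lemma inord_neq i j : (i <= d)%N -> (j <= d)%N -> i != j ->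
  (inord i : 'I_d.+1) != inord j.
Proof. by move=> di dj; rewrite -val_eqE /= !inordK. Qed.

Lemma hs_hxS k : (k < d)%N -> hs k * hx k.+1 = hx k * hs k + 1.
Proof. by move=> kd; apply: dah_perm_X; rewrite !inordK // ltnS ltnW. Qed.

Lemma hxS k : (k < d)%N -> hx k.+1 = hs k * hx k * hs k + hs k.
Proof.
move=> kd; have := congr1 (fun h => hs k * h) (hs_hxS kd).
by rewrite /= mulrA htK mul1r mulrDr mulr1 mulrA.
Qed.

Lemma hs_hx k j : (k < d)%N -> (j <= d)%N -> j != k -> j != k.+1 ->
  hs k * hx j = hx j * hs k.
Proof.
move=> kd jd jk jk1; apply: dah_perm_X_far.
- by rewrite !inordK // ltnS ltnW.
- by apply: inord_neq => //; apply: ltnW.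
- exact: inord_neq.
Qed.

Lemma hs_ht_far k i j : (k < d)%N -> (i <= d)%N -> (j <= d)%N ->
  k != i -> k != j -> k.+1 != i -> k.+1 != j -> hs k * ht i j = ht i j * hs k.
Proof.
move=> kd di dj ki kj k1i k1j; rewrite /hs /ht -!dah_permM;
  congr (dah_perm H _).
apply/esym/commgP; apply/conjg_fixP; rewrite tpermJ !tpermD //;
  by apply: inord_neq => //; apply: ltnW.
Qed.

Lemma hs_far i j : (i < d)%N -> (j < d)%N -> (i.+1 < j)%N ->
  hs i * hs j = hs j * hs i.
Proof. by move=> di dj ij; apply: hs_ht_far => //; lia. Qed.

Lemma hs_htS k i : (k < d)%N -> (i < k)%N ->
  hs k * ht i k * hs k = ht i k.+1.
Proof.
move=> kd ik; rewrite /hs /ht -!dah_permM; congr (dah_perm H _).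
rewrite -{1}(tpermV (inord k)) -mulgA -conjgE tpermJ tpermL tpermD //;
  by apply: inord_neq; lia.
Qed.

Lemma ht_3cycle k i : (k < d)%N -> (i < k)%N ->
  hs k * ht i k.+1 = ht i k.+1 * ht i k.
Proof.
move=> kd ik; rewrite /hs /ht -!dah_permM; congr (dah_perm H _).
rewrite conjgC tpermJ tpermR [tperm _ _ (inord k)]tpermD;
  by [rewrite [tperm (inord k) _]tpermC | apply: inord_neq; lia].
Qed.

Lemma hs_braid i : (i.+1 < d)%N ->
  hs i * hs i.+1 * hs i = hs i.+1 * hs i * hs i.+1.
Proof.
move=> id; rewrite hs_htS //.
rewrite /hs /ht -!dah_permM; congr (dah_perm H _).
rewrite -{1}(tpermV (inord i)) -mulgA -conjgE tpermJ tpermR tpermD //;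
  by apply: inord_neq; lia.
Qed.

(** * Rows and weights for a single parameter *)

Definition subspace (W : V -> Prop) : Prop :=
  [/\ W 0, forall u v, W u -> W v -> W (u + v)
    & forall c v, W v -> W (sc c v)].

(** Stability under the symmetric group of the positions [n], ..., [m - 1]. *)
Definition hs_stable n m (W : V -> Prop) : Prop :=
  forall i v, (n <= i)%N -> (i.+1 < m)%N -> W v -> W (hs i *: v).

Definition hx_stable n m (W : V -> Prop) : Prop :=
  forall i v, (n <= i < m)%N -> W v -> W (hx i *: v).

Lemma subspaceB W u v : subspace W -> W u -> W v -> W (u - v).
Proof.
case=> _ WD WZ Wu Wv; apply: (WD) => //.
by have := WZ (-1) _ Wv; rewrite scaleN1r scaleNr scale1r.
Qed.

Lemma subspace_ht W n m i j v : hs_stable n m W -> (m <= d.+1)%N ->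
  (n <= i)%N -> (i < j < m)%N -> W v -> W (ht i j *: v).
Proof.
move=> sW md ni; elim: j v => [|j IHj] v //; case/andP=> ij jm Wv.
have [e|ij'] := eqVneq i j; first by rewrite -e; apply: (sW) => //; lia.
rewrite -hs_htS; [|lia|lia]; rewrite -!scalerA.
by apply: (sW); try lia; apply: (IHj); [lia|apply: (sW); try lia].
Qed.

Lemma ht_fix a b v : (b <= d)%N ->
    (forall i, (a <= i < b)%N -> hs i *: v = v) ->
  forall i j, (a <= i)%N -> (i < j <= b)%N -> ht i j *: v = v.
Proof.
move=> bd vs i j ai; elim: j => [//|j IHj] /andP[ij jb].
have [e|ij'] := eqVneq i j; first by rewrite -e; apply: vs; lia.
rewrite -hs_htS; [|lia|lia]; rewrite -!scalerA (vs j); last lia.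
by rewrite IHj; [apply: vs; lia|lia].
Qed.

(* Conjugation by a transposition moves an invariant block to its left. *)
Lemma hs_shift1 W n m a b v : hs_stable n m W -> (m <= d.+1)%N ->
    (n <= a)%N -> (a <= b)%N -> (b.+1 < m)%N ->
    W v -> v != 0 -> (forall i, (a < i <= b)%N -> hs i *: v = v) ->
  exists u, [/\ W u, u != 0 & forall i, (a <= i < b)%N -> hs i *: u = u].
Proof.
move=> sW md na ab bm Wv v0 vs; exists (ht a b.+1 *: v); split.
- by apply: subspace_ht sW md na _ Wv; lia.
- by apply: contraNneq v0 => /(congr1 (fun u => ht a b.+1 *: u)) /eqP;
    rewrite scalerA htK scale1r scaler0.
move=> i /andP[ai ib]; rewrite scalerA; have [<-|ai'] := eqVneq a i; last first.
  by rewrite hs_ht_far; [rewrite -scalerA vs //; lia | lia..].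
have -> : hs a * ht a b.+1 = ht a b.+1 * ht a.+1 b.+1.
  rewrite /hs /ht -!dah_permM; congr (dah_perm H _).
  rewrite conjgC tpermJ tpermL [tperm _ _ (inord a.+1)]tpermD;
    by [rewrite [tperm (inord b.+1) _]tpermC | apply: inord_neq; lia].
rewrite -scalerA; congr (_ *: _); apply: (@ht_fix a.+1 b.+1); try lia.
by move=> j aj; apply: vs; lia.
Qed.

Lemma hs_shift W n m a L v : hs_stable n m W -> (m <= d.+1)%N ->
    (n <= a)%N -> (a + L < m)%N ->
    W v -> v != 0 -> (forall i, (a <= i < a + L)%N -> hs i *: v = v) ->
  exists u, [/\ W u, u != 0 & forall i, (n <= i < n + L)%N -> hs i *: u = u].
Proof.
move=> sW md; elim: a v => [|a IHa] v na aL Wv v0 vs.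
  by exists v; split=> // i; move: na; rewrite leqn0 => /eqP ->; apply: vs.
have [e|na'] := eqVneq n a.+1; first by exists v; rewrite e; split.
have [u [Wu u0 us]] : exists u,
    [/\ W u, u != 0 & forall i, (a <= i < a + L)%N -> hs i *: u = u].
  have [->|L0] := posnP L; first by exists v; split=> // i; lia.
  have [] := @hs_shift1 W n m a (a + L) v sW md _ _ _ Wv v0; try lia.
    by move=> i ai; apply: vs; lia.
  by move=> u [? ? ?]; exists u.
by apply: (IHa u) => //; lia.
Qed.

(** Iterating [hxS] shows that the variable at position [n + j] acts on [W] as [q] plus a
    Jucys-Murphy element. *)
Lemma hx_level1 W n m q j v :
    subspace W -> hs_stable n m W -> (m <= d.+1)%N ->
    (forall v, W v -> hx n *: v = sc q v) ->
    (n + j < m)%N -> W v ->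
  hx (n + j) *: v = sc q v + \sum_(n <= i < n + j) ht i (n + j) *: v.
Proof.
move=> subW sW md xq; elim: j v => [|j IHj] v jm Wv.
  by rewrite addn0 big_geq // addr0 xq.
rewrite addnS in jm *; rewrite hxS; last lia.
rewrite scalerDl -!scalerA IHj; [|lia|by apply: (sW) => //; lia].
rewrite scalerDr scC hsK -addrA big_nat_recr ?leq_addr //=.
congr (_ + (_ + _)); rewrite scaler_sumr !big_nat; apply: eq_bigr => i ij.
by rewrite !scalerA hs_htS //; lia.
Qed.

(** On an invariant vector each of the [j] transpositions in [hx_level1] acts by 1; this gives the
    residues along a row. *)
Lemma hx_fix W n m q L j v :
    subspace W -> hs_stable n m W -> (m <= d.+1)%N ->
    (forall v, W v -> hx n *: v = sc q v) ->
    (n + L < m)%N -> (j <= L)%N -> W v ->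
    (forall i, (n <= i < n + L)%N -> hs i *: v = v) ->
  hx (n + j) *: v = sc (q + j%:R) v.
Proof.
move=> subW sW md xq Lm jL Wv vs; rewrite (hx_level1 subW sW md xq) //;
  last lia.
rewrite scalerDl scalerDl; congr (_ + _).
rewrite big_nat (eq_bigr (fun=> v)) => [|i ij].
  by rewrite -big_nat sumr_const_nat addKn scaler_nat scaler_nat.
by apply: (ht_fix _ vs); lia.
Qed.

(* [u] is the sum of [w *: v] over coset representatives [w] of [S_(L+1)] in  *)
(* [S_(L+2)].                                                                 *)
Lemma hs_ht_l k j : (k < d)%N -> (k.+1 < j <= d)%N ->
  hs k * ht k j = ht k.+1 j * hs k.
Proof.
move=> kd kj; rewrite /hs /ht -!dah_permM; congr (dah_perm H _).
by rewrite [RHS]conjgC tpermJ tpermR tpermD //; apply: inord_neq; lia.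
Qed.

(** If no nonzero vector is invariant under one more position, then [u] is 0 and the next variable
    acts on [v] by [q - 1], the residue that begins the next row. *)
Lemma hx_next_row W n m q L v :
    subspace W -> hs_stable n m W -> (m <= d.+1)%N ->
    (forall v, W v -> hx n *: v = sc q v) ->
    (n + L.+1 < m)%N -> W v ->
    (forall i, (n <= i < n + L)%N -> hs i *: v = v) ->
  let u := hx (n + L.+1) *: v - sc (q - 1) v in
  W u /\ forall i, (n <= i < n + L.+1)%N -> hs i *: u = u.
Proof.
move=> subW sW md xq Lm Wv vs u.
have uE : u = v + \sum_(n <= i < n + L.+1) ht i (n + L.+1) *: v.
  rewrite /u (hx_level1 subW sW md xq) // -scB [1%:A]scale1r scale1r.
  by rewrite opprB addrC addrA subrK.
split.
  rewrite uE; case: (subW) => W0 WD _; apply: (WD) => //.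
  rewrite big_nat; elim/big_rec: _ => // i w iL Ww; apply: (WD) => //.
  by apply: subspace_ht sW md _ _ Wv; lia.
move=> i iL; rewrite uE scalerDr scaler_sumr.
rewrite addnS; have [->|neiL] := eqVneq i (n + L)%N; last first.
  rewrite vs; last lia; congr (_ + _).
  (* Here [hs i] exchanges the summands [i] and [i.+1] and fixes the others. *)
  pose f k := ht k (n + L).+1 *: v.
  have sf k : k != i -> k != i.+1 -> (k < (n + L).+1)%N -> hs i *: f k = f k.
    move=> ki ki1 kL; rewrite scalerA hs_ht_far; try lia.
    by rewrite -scalerA vs //; lia.
  have sfi : hs i *: f i = f i.+1.
    by rewrite scalerA hs_ht_l; [rewrite -scalerA vs //; lia|lia..].
  have sfi1 : hs i *: f i.+1 = f i by rewrite -sfi hsK.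
  rewrite -!/(f _) [in RHS](@big_cat_nat _ _ _ i) /=; [|lia|lia].
  rewrite [in LHS](@big_cat_nat _ _ _ i) /=; [|lia|lia].
  rewrite !(@big_ltn _ _ _ i) /=; [|lia|lia].
  rewrite !(@big_ltn _ _ _ i.+1) /=; [|lia|lia].
  rewrite sfi sfi1 [X in _ + X = _]addrCA; congr (_ + (_ + (_ + _)));
    by rewrite !big_nat; apply: eq_bigr => k kL; apply: sf; lia.
(* The last reflection exchanges [v] with the summand [n + L]; in the other summands [ht_3cycle]
   leaves a transposition that fixes [v]. *)
rewrite [in LHS]big_nat_recr ?leq_addr //= [in RHS]big_nat_recr ?leq_addr //=.
rewrite hsK addrCA [RHS]addrCA; congr (_ + _); last exact: addrC.
rewrite !big_nat; apply: eq_bigr => k kL.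
rewrite scalerA ht_3cycle; [|lia|lia]; rewrite -scalerA; congr (_ *: _).
by apply: (ht_fix _ vs); lia.
Qed.

(** Rows are split off one at a time. The first row has the greatest length [L.+1] for which a
    nonzero vector of [W] is invariant on a block of [L.+1] positions; the induction continues on
    the invariants of the first block, with [q - 1]. The condition on [K] bounds the rows and makes
    their lengths decrease. *)
Lemma level1_residues n m q W K :
    subspace W -> hs_stable n m W -> (n <= m <= d.+1)%N ->
    (forall v, (n < m)%N -> W v -> hx n *: v = sc q v) ->
    (exists2 v, W v & v != 0) ->
    (forall a v, (n <= a)%N -> (a + K < m)%N -> W v ->
       (forall i, (a <= i < a + K)%N -> hs i *: v = v) -> v = 0) ->
  exists kappa : seq nat, [/\ is_partition kappa, all (fun k => k <= K)%N kappa,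
    sumn kappa = (m - n)%N & exists v, [/\ W v, v != 0 &
      forall i, (i < m - n)%N ->
        hx (n + i) *: v = sc (nth 0 (residues q kappa) i) v]].
Proof.
have [M leM] := ubnP (m - n); elim: M => // M IHM in n q W K leM *.
move=> subW sW /andP[nm md] xq [v0 Wv0 v00] noK.
have [e|ltnm] := eqVneq n m.
  exists [::]; rewrite e subnn; split=> //; by exists v0; split.
(* The block may start anywhere, so that the failure of [Q L.+1] also bounds the later rows. A block
   of [L.+1] positions has [L] simple reflections. *)
pose Q L := exists a v, [/\ (n <= a)%N, (a + L < m)%N, W v, v != 0
  & forall i, (a <= i < a + L)%N -> hs i *: v = v].
have [L [[a [v [na aL Wv vn0 vs]]] QL]] : exists L, Q L /\ ~ Q L.+1.
  apply: (@ex_last _ m); first by exists n, v0; split=> // *; lia.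
  by case=> a [v [? ? _ _ _]]; lia.
have LK : (L < K)%N.
  rewrite ltnNge; apply/negP => KL; move/eqP: vn0; apply.
  by apply: (noK a) => // *; [lia | apply: vs; lia].
have nL : (n + L < m)%N by lia.
have {a v na aL Wv vn0 vs} [v [Wv vn0 vs]] := hs_shift sW md na aL Wv vn0 vs.
pose W' u := W u /\ forall i, (n <= i < n + L)%N -> hs i *: u = u.
have xqW u : W u -> hx n *: u = sc q u by apply: xq; lia.
have [] := IHM (n + L.+1)%N (q - 1) W' L.+1.
- lia.
- case: (subW) => W0 WD WZ; split.
  + by split=> // i _; rewrite scaler0.
  + move=> u u' [Wu us] [Wu' us']; split; first exact: WD.
    by move=> i iL; rewrite scalerDr us ?us'.
  + by move=> c u [Wu us]; split; [apply: WZ | move=> i iL; rewrite scC us].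
- move=> i u ni im [Wu us]; split; first by apply: (sW) => //; lia.
  move=> k kL; rewrite scalerA hs_far; [|lia..].
  by rewrite -scalerA us.
- lia.
(* If the next variable did not act by [q - 1], the difference would be a nonzero vector invariant
   on a longer block. *)
- move=> u nLm [Wu us].
  have [W1 s1] := hx_next_row subW sW md xqW nLm Wu us.
  apply/eqP; rewrite -subr_eq0; apply/eqP.
  apply: NNPP => /eqP u0; apply: QL; exists n; eexists; split; last exact: s1.
  + by [].
  + lia.
  + exact: W1.
  + exact: u0.
- by exists v.
- move=> a u na aL [Wu us] us'; apply: NNPP => /eqP u0; apply: QL.
  by exists a, u; split=> //; lia.
move=> kappa [/andP[srt n0k] kL szk [u [[Wu us] u0 ux]]].
exists (L.+1 :: kappa); split.
- rewrite /is_partition /= inE n0k andbT path_min_sorted ?srt //.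
- rewrite /= LK /=; apply: sub_all kL => k; lia.
- rewrite /= szk; lia.
exists u; split=> // i im; rewrite residues_cons nth_cat size_map size_iota.
case: ltnP => iL.
  rewrite (nth_map 0%N) ?size_iota // nth_iota // add0n.
  by apply: (hx_fix subW sW md xqW nL).
by rewrite -ux; [congr (hx _ *: _); lia | lia].
Qed.

(* [hy n k] is [x_n] conjugated by the transposition [(n n+k)], and [hxy n k] *)
(* is the sum of the transpositions [(i n+k)] with [n <= i < n+k].            *)
Fixpoint hy n k : H :=
  if k is k'.+1 then hs (n + k') * hy n k' * hs (n + k') else hx n.

Fixpoint hxy n k : H :=
  if k is k'.+1 then hs (n + k') * hxy n k' * hs (n + k') + hs (n + k') else 0.

Lemma hx_split n k : (n + k <= d)%N -> hx (n + k) = hy n k + hxy n k.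
Proof.
elim: k => [|k IHk] nk; first by rewrite addn0 addr0.
rewrite addnS hxS /=; last lia; rewrite IHk; last lia.
by rewrite mulrDr mulrDl addrA.
Qed.

Lemma hs_hy_far n k i : (i < d)%N -> (n + k < i)%N ->
  hs i * hy n k = hy n k * hs i.
Proof.
move=> id; elim: k => [|k IHk] ki /=; first by apply: hs_hx; lia.
have sC : hs i * hs (n + k) = hs (n + k) * hs i by rewrite -hs_far //; lia.
by rewrite !mulrA sC -!mulrA -sC; congr (_ * _); rewrite !mulrA IHk //; lia.
Qed.

(** In the critical case a braid relation turns [hs i] into [hs i.+1], which passes the inner [hy],
    and a second braid relation turns it back. *)
Lemma hs_hy n k i : (n + k <= d)%N -> (n <= i)%N -> (i.+1 < n + k)%N ->
  hs i * hy n k = hy n k * hs i.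
Proof.
move=> nk ni; elim: k nk => [|k IHk] nk ik /=; first lia.
have [e|ne] := eqVneq (n + k)%N i.+1; last first.
  have sC : hs i * hs (n + k) = hs (n + k) * hs i by apply: hs_far; lia.
  by rewrite !mulrA sC -!mulrA -sC; congr (_ * _); rewrite !mulrA IHk //; lia.
case: k e {IHk} nk ik => [|k] e nk ik; first lia.
have {}e : (n + k)%N = i by lia.
rewrite addnS e /= e !mulrA hs_braid; last lia.
have yC : hs i.+1 * hy n k = hy n k * hs i.+1 by apply: hs_hy_far; lia.
rewrite -(mulrA _ (hs i.+1) (hy n k)) yC mulrA.
have bE x : x * hs i.+1 * hs i * hs i.+1 = x * hs i * hs i.+1 * hs i.
  by rewrite -!mulrA; congr (x * _); rewrite !mulrA hs_braid //; lia.
by rewrite bE.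
Qed.

Lemma hx_hy n k j : (j <= d)%N -> (n + k < j)%N -> hx j * hy n k =
  hy n k * hx j.
Proof.
move=> jd; elim: k => [|k IHk] kj /=; first exact: hxC.
have sC : hs (n + k) * hx j = hx j * hs (n + k) by apply: hs_hx; lia.
by rewrite !mulrA -sC -!mulrA sC; congr (_ * _); rewrite !mulrA IHk //; lia.
Qed.

(* Since [hx (n + k) = hy n k + hxy n k], the factor [hy n k - q] allows one to *)
(* replace [hy n k] by [hx (n + k)].                                          *)
Lemma hy_hxy n k q v : (n + k <= d)%N ->
  (forall i, (i < k)%N -> hy n i *: v = sc q v) ->
  (hy n k - q%:A) *: (hxy n k *: v) = 0.
Proof.
elim: k v => [|k IHk] v nk yv /=; first by rewrite scale0r scaler0.
rewrite scalerDl scalerDr -!scalerA.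
have E (u : V) : (hs (n + k) * hy n k * hs (n + k) - q%:A) *: (hs (n + k) *:
  u) =
    hs (n + k) *: ((hy n k - q%:A) *: u).
  rewrite !scalerBl scalerBr scC -!scalerA hsK; congr (_ - _).
rewrite !E IHk; [|lia|].
  by rewrite scaler0 add0r scalerBl yv // subrr scaler0.
by move=> i ik; rewrite -scC -(yv i) ?scalerA ?hs_hy_far //; lia.
Qed.

(** The product of the [h - q] applied to [v]. The head of [qs] gives the outermost factor, the one
    to be peeled off. *)
Definition hprod (qs : seq F) (h : H) v : V :=
  foldr (fun q u => (h - q%:A) *: u) v qs.

Lemma hprod_hy n k qs W m v : (n + k < m)%N -> hs_stable n m W ->
    (forall v, W v -> hprod qs (hx n) v = 0) -> W v ->
  hprod qs (hy n k) v = 0.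
Proof.
move=> nkm sW x0; elim: k v nkm => [|k IHk] v nkm Wv /=; first exact: x0.
suff -> : hprod qs (hs (n + k) * hy n k * hs (n + k)) v =
    hs (n + k) *: hprod qs (hy n k) (hs (n + k) *: v).
  by rewrite IHk ?scaler0 //; [lia|apply: (sW) => //; lia].
elim: qs {x0 IHk} => [|q qs IHqs] /=; first by rewrite hsK.
by rewrite IHqs !scalerBl scalerBr scC -!scalerA hsK.
Qed.

(** Induction over the parameters. With [k] maximal such that some nonzero vector of [W] has
    eigenvalue [q] for the first [k] conjugates [hy n i], these eigenvectors provide the component
    of [q], and the other parameters account for the positions from [n + k] on. *)
Lemma weight_exists qs n W :
    (n <= d.+1)%N -> subspace W -> hs_stable n d.+1 W -> hx_stable n d.+1 W ->
    (forall v, (n <= d)%N -> W v -> hprod qs (hx n) v = 0) ->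
    (exists2 v, W v & v != 0) ->
  exists lam : seq (seq nat), let R :=
      flatten [seq residues p.1 p.2 | p <- zip qs lam] in
    [/\ size lam = size qs, all is_partition lam, size R = (d.+1 - n)%N
      & exists v, [/\ W v, v != 0 &
        forall i, (i < d.+1 - n)%N -> hx (n + i) *: v = sc (nth 0 R i) v]].
Proof.
elim: qs n W => [|q qs IHqs] n W nd subW sW xW kill [v0 Wv0 v00].
  have en : n = d.+1.
    apply/eqP; rewrite eqn_leq nd ltnNge; apply/negP => nd'.
    by move: (kill v0 nd' Wv0) v00 => /= ->; rewrite eqxx.
  by exists [::]; rewrite /= en subnn; split=> //; exists v0.
pose Vk k v := W v /\ forall i, (i < k)%N -> hy n i *: v = sc q v.
pose Q k := (n + k <= d.+1)%N /\ exists2 v, Vk k v & v != 0.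
have [k [[nk [v Vkv vn0]] Qk]] : exists k, Q k /\ ~ Q k.+1.
  by apply: (@ex_last _ d.+2); [split; [lia|by exists v0] | case; lia].
have subVk : subspace (Vk k).
  case: (subW) => W0 WD WZ; split.
  - by split=> // i _; rewrite !scaler0.
  - move=> u u' [Wu yu] [Wu' yu']; split; first exact: WD.
    by move=> i ik; rewrite !scalerDr yu ?yu'.
  - by move=> c u [Wu yu]; split; [apply: WZ|move=> i ik;
    rewrite scC yu // -scC].
have sVk : hs_stable (n + k) d.+1 (Vk k).
  move=> i u ki id [Wu yu]; split; first by apply: (sW) => //; lia.
  by move=> j jk; rewrite scalerA -hs_hy_far;
    [rewrite -scalerA yu // scC|lia..].
have xVk : hx_stable (n + k) d.+1 (Vk k).
  move=> i u ki [Wu yu]; split; first by apply: xW => //; lia.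
  by move=> j jk; rewrite scalerA -hx_hy; [rewrite -scalerA yu // scC|lia..].
(* The product in [x] applied to [u] stays in [Vk k]. After the factor [y - q], every [x] in it may
   be replaced by [y], and the full product in [y] is 0; so a nonzero result would contradict the
   choice of [k]. *)
have killVk u : (n + k <= d)%N -> Vk k u -> hprod qs (hx (n + k)) u = 0.
  move=> nkd Vu; set x := hx _; set y := hy n k.
  have Vx rs w : Vk k w -> Vk k (hprod rs x w).
    elim: rs => //= r rs IH /IH Vw; rewrite scalerBl; apply: subspaceB => //.
      by apply: xVk => //; lia.
    by case: subVk => _ _; apply.
  have xy rs : (y - q%:A) *: hprod rs x u = (y - q%:A) *: hprod rs y u.
    elim: rs => //= r rs IH.
    have [_ yx] := Vx rs _ Vu.
    have := hy_hxy nkd yx; rewrite -/y => Ky.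
    have -> : x - r%:A = (y - r%:A) + hxy n k.
      by rewrite /x hx_split // addrAC.
    have C w : (y - q%:A) *: ((y - r%:A) *: w) =
      (y - r%:A) *: ((y - q%:A) *: w).
      rewrite !scalerA; congr (_ *: _).
      have cA (h : H) c : GRing.comm h c%:A by rewrite /GRing.comm mulr_algl
        mulr_algr.
      by apply: commrB; [apply: commr_sym; apply: commrB|].
    by rewrite [(_ + hxy _ _) *: _]scalerDl scalerDr Ky addr0 C IH C.
  apply: NNPP => /eqP u0; apply: Qk; split; first lia.
  exists (hprod qs x u) => //; split; first by case: (Vx qs u Vu).
  move=> i; rewrite ltnS leq_eqVlt => /predU1P[->|ik]; last first.
    by case: (Vx qs u Vu) => _; apply.
  apply/eqP; rewrite -subr_eq0 -scalerBl xy.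
  apply/eqP; apply: (@hprod_hy n k (q :: qs) W d.+1 u _ sW _ Vu.1); first lia.
  by move=> w Ww; apply: kill => //; lia.
have nkd : (n <= n + k <= d.+1)%N by rewrite leq_addr.
have [] := @level1_residues n (n + k) q (Vk k) k subVk _ nkd.
- move=> i u ni ik [Wu yu]; split; first by apply: (sW) => //; lia.
  (* [hs i] exchanges the conjugates at the positions [i] and [i.+1] and commutes with the
     others. *)
  move=> j jk; have [ji|ji|eji] := ltngtP (n + j)%N i.
  + by rewrite scalerA -hs_hy_far; [rewrite -scalerA yu // scC|lia..].
  + have [e|ne] := eqVneq (n + j)%N i.+1; last first.
      by rewrite scalerA -hs_hy; [rewrite -scalerA yu // scC|lia..].
    case: j e jk {ji} => [|j] e jk; first lia.
    have {}e : (n + j)%N = i by lia.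
    rewrite /= e scalerA -[_ * hs i * hs i]mulrA htK mulr1 -scalerA yu ?scC //.
    by lia.
  + have := yu j.+1; rewrite /= eji => yj1.
    rewrite -[LHS](hsK i) -[RHS]scC; congr (_ *: _).
    by rewrite !scalerA yj1 //; lia.
- by move=> u nk0 [Wu yu]; rewrite -(yu 0%N) //; lia.
- by exists v.
(* With [K := k] the bound is automatic: a block of [k.+1] positions does not fit into [k] of
   them. *)
- by move=> a u na ak; exfalso; lia.
move=> kappa [kapP _ szk [v1 [Vv1 v10 v1x]]].
(* The weights found so far are frozen; reflections and variables at later positions preserve
   them. *)
pose W' u := Vk k u /\ forall i, (i < k)%N ->
  hx (n + i) *: u = sc (nth 0 (residues q kappa) i) u.
have [] := IHqs (n + k)%N W' nk.
- case: subVk => W0 WD WZ; split.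
  + by split=> // i _; rewrite !scaler0.
  + move=> u u' [Wu yu] [Wu' yu']; split; first exact: WD.
    by move=> i ik; rewrite !scalerDr yu ?yu'.
  + by move=> c u [Wu yu]; split; [apply: WZ|move=> i ik;
    rewrite scC yu // -scC].
- move=> i u ki id [Wu yu]; split; first by apply: (sVk) => //; lia.
  by move=> j jk; rewrite scalerA -hs_hx; [rewrite -scalerA yu // scC|lia..].
- move=> i u ki [Wu yu]; split; first by apply: xVk => //; lia.
  by move=> j jk; rewrite scalerA hxC -scalerA yu // scC.
- by move=> u nkd' [Vu _]; apply: killVk.
- by exists v1 => //; split=> // i ik; apply: v1x; lia.
rewrite addKn in szk.
move=> lam [slam lamP szR [u [[Vu ux] u0 uR]]]; exists (kappa :: lam) => R.
split=> /=; rewrite ?slam ?kapP //.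
  by rewrite size_cat size_residues szR szk; lia.
exists u; split=> //; first by case: Vu.
move=> i id; rewrite nth_cat size_residues szk; case: ltnP => ik;
  first exact: ux.
by rewrite -uR; [congr (hx _ *: _); lia | lia].
Qed.

End HeckeModule.

(** * Modules with a given central character *)

Section LeftIdealQuotient.

Variables (A : nzRingType) (I : A -> Prop).
Hypotheses (I0 : I 0) (IB : forall a b, I a -> I b -> I (a - b)).
Hypothesis IM : forall h a, I a -> I (h * a).

(** Excluded middle makes membership boolean, as the quotient construction demands. *)
Definition in_ideal (a : A) : bool := excluded_middle_informative (I a).

Lemma in_idealP a : reflect (I a) (in_ideal a).
Proof. by rewrite /in_ideal; case: excluded_middle_informative => ?;
  constructor. Qed.

Fact in_ideal_zmod_closed : zmod_closed in_ideal.
Proof.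
split; first exact/in_idealP.
by move=> a b /in_idealP Ia /in_idealP Ib; apply/in_idealP/IB.
Qed.

HB.instance Definition _ :=
  GRing.isZmodClosed.Build A in_ideal in_ideal_zmod_closed.

Let J : zmodClosed A := GRing.ZmodClosed.clone A in_ideal _.
Local Notation Q := (Quotient.quot J).

Let pi_eq (a b : A) : (\pi_Q a = \pi_Q b)%qT <-> I (a - b).
Proof.
split=> [/eqP|/in_idealP Iab];
  first by rewrite -Quotient.idealrBE => /in_idealP.
by apply/eqP; rewrite -Quotient.idealrBE.
Qed.

Fact quot_scale_key :
  {f : A -> Q -> Q | forall h a, f h (\pi_Q a)%qT = (\pi_Q (h * a))%qT}.
Proof.
exists (fun h v => \pi_Q (h * generic_quotient.repr v))%qT => h a.
by apply/pi_eq; rewrite -mulrBr; apply: IM; apply/pi_eq; rewrite reprK.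
Qed.

Definition quot_scale : A -> Q -> Q := sval quot_scale_key.

Let scale_pi h a : quot_scale h (\pi_Q a)%qT = (\pi_Q (h * a))%qT.
Proof. exact: (svalP quot_scale_key). Qed.

Fact quot_scaleA a b v : quot_scale a (quot_scale b v) = quot_scale (a * b) v.
Proof. by elim/quotW: v => v; rewrite !scale_pi mulrA. Qed.

Fact quot_scale1 : left_id 1 quot_scale.
Proof. by elim/quotW=> v; rewrite scale_pi mul1r. Qed.

Fact quot_scaleDr : right_distributive quot_scale +%R.
Proof.
by move=> a; elim/quotW=> u; elim/quotW=> v;
  rewrite -raddfD !scale_pi mulrDr raddfD.
Qed.

Fact quot_scaleDl v : {morph quot_scale^~ v : a b / a + b}.
Proof. by move=> a b; elim/quotW: v => v; rewrite !scale_pi mulrDl raddfD. Qed.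

HB.instance Definition _ := GRing.Zmodule_isLmodule.Build A Q
  quot_scaleA quot_scale1 quot_scaleDr quot_scaleDl.

Lemma left_ideal_quotient : exists (V : lmodType A) (p : A -> V),
  [/\ forall h a, p (h * a) = h *: p a, forall v, exists a, v = p a
    & forall a, p a = 0 <-> I a].
Proof.
exists Q, (fun a => \pi_Q a)%qT; split.
- by move=> h a; apply/esym/scale_pi.
- by elim/quotW=> a; exists a.
- by move=> a; rewrite -(raddf0 \pi_Q%qT) pi_eq subr0.
Qed.

End LeftIdealQuotient.

(** * Polynomials as a finite module over the symmetric ones *)

Section SymmetricSpan.

Variables (F : fieldType) (d : nat).

Definition generic_poly : {poly {mpoly F[d]}} := \prod_(i < d) ('X - ('X_i)%:P).

Lemma generic_poly_sym j : generic_poly`_j \is symmetric.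
Proof.
apply/issymP => s; rewrite -coef_map.
suff -> : map_poly (msym s) generic_poly = generic_poly by [].
rewrite rmorph_prod /generic_poly [RHS](reindex_inj (@perm_inj _ s)).
by apply: eq_bigr => i _; rewrite rmorphB /= map_polyX map_polyC /= msymXi.
Qed.

Lemma size_generic_poly : size generic_poly = d.+1.
Proof. by rewrite size_prod_XsubC -[index_enum _]enumT size_enum_ord. Qed.

(** ['X_k] is a root of the monic polynomial [generic_poly], whose coefficients are symmetric. *)
Lemma mpolyX_integral (k : 'I_d) : exists c : 'I_d -> {mpoly F[d]},
  (forall j, c j \is symmetric) /\ 'X_k ^+ d = \sum_j c j * 'X_k ^+ j.
Proof.
exists (fun j => - generic_poly`_j); split.
  by move=> j; rewrite rpredN generic_poly_sym.
have : generic_poly.['X_k] = 0.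
  have -> : generic_poly =
    ('X - ('X_k)%:P) * \prod_(i | i != k) ('X - ('X_i)%:P).
    exact: bigD1.
  by rewrite hornerM hornerXsubC subrr mul0r.
rewrite horner_coef size_generic_poly big_ord_recr /=.
have -> : generic_poly`_d = 1.
  have /monicP := monic_prod_XsubC (index_enum 'I_d) xpredT (fun i =>
    'X_i : {mpoly F[d]}).
  by rewrite lead_coefE -/generic_poly size_generic_poly.
rewrite mul1r => /(canRL (addKr _)) ->; rewrite addr0 -sumrN.
by apply: eq_bigr => j _; rewrite mulNr.
Qed.

Definition small_monomial (a : {ffun 'I_d -> 'I_d}) : {mpoly F[d]} :=
  \prod_i 'X_i ^+ (a i).

(** Multiplying a small monomial by ['X_k] gives a small monomial or an exponent [d], which
    integrality lowers. *)
Lemma symmetric_span (p : {mpoly F[d]}) : (0 < d)%N ->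
  exists2 g : {ffun 'I_d -> 'I_d} -> {mpoly F[d]}, forall a, g a \is symmetric
    & p = \sum_a g a * small_monomial a.
Proof.
move=> d0; pose S p := exists2 g : {ffun 'I_d -> 'I_d} -> {mpoly F[d]},
  forall a, g a \is symmetric & p = \sum_a g a * small_monomial a.
have SD p1 p2 : S p1 -> S p2 -> S (p1 + p2).
  move=> [g1 g1s ->] [g2 g2s ->]; exists (fun a => g1 a + g2 a).
    by move=> a; rewrite rpredD.
  by rewrite -big_split; apply: eq_bigr => a _; rewrite mulrDl.
have S0 : S 0.
  by exists (fun=> 0) => [a|]; rewrite ?rpred0 // big1 // => a _; rewrite mul0r.
have SM g p1 : g \is symmetric -> S p1 -> S (g * p1).
  move=> gs [g1 g1s ->]; exists (fun a => g * g1 a).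
    by move=> a; rewrite rpredM.
  by rewrite mulr_sumr; apply: eq_bigr => a _; rewrite mulrA.
have Sb a : S (small_monomial a).
  exists (fun a' => (a' == a)%:R).
    by move=> a'; case: (a' == a); [exact: rpred1|exact: rpred0].
  rewrite (bigD1 a) //= eqxx mul1r big1 ?addr0 // => a' /negPf ->.
  by rewrite mul0r.
have Ssum (I : finType) (f : I -> {mpoly F[d]}) : (forall i,
  S (f i)) -> S (\sum_i f i).
  by move=> Sf; elim/big_ind: _.
have SXb k a : S ('X_k * small_monomial a).
  have E : 'X_k * small_monomial a =
      'X_k ^+ (a k).+1 * \prod_(i | i != k) 'X_i ^+ (a i).
    by rewrite /small_monomial (bigD1 k) //= mulrA -exprS.
  have upd (j : 'I_d) : 'X_k ^+ j * \prod_(i | i != k) 'X_i ^+ (a i) =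
      small_monomial [ffun i => if i == k then j else a i].
    rewrite /small_monomial [RHS](bigD1 k) //= ffunE eqxx; congr (_ * _).
    by apply: eq_bigr => i /negPf ik; rewrite ffunE ik.
  have [lt|ge] := ltnP (a k).+1 d; first by rewrite E (upd (Ordinal lt)).
  have ad : (a k).+1 = d by apply/eqP; rewrite eqn_leq ge ltn_ord.
  have [c [cs cE]] := mpolyX_integral k.
  rewrite E ad cE mulr_suml; apply: Ssum => j.
  by rewrite -mulrA upd; apply: SM.
have SX k p1 : S p1 -> S ('X_k * p1).
  move=> [g gs ->]; rewrite mulr_sumr; apply: Ssum => a.
  by rewrite mulrCA; apply: SM.
have S1 : S 1.
  have := Sb [ffun=> Ordinal d0]; congr S.
  by rewrite /small_monomial big1 // => i _; rewrite ffunE expr0.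
have SXm m p1 : S p1 -> S ('X_[m] * p1).
  rewrite mpolyXE_id; elim/big_rec: _ => [|i q _ IH] Sp; first by rewrite mul1r.
  rewrite -mulrA; elim: (m i) => [|n IHn]; first by rewrite expr0 mul1r;
    apply: IH.
  by rewrite exprS -mulrA; apply: SX.
elim/mpolyind: p => [//|c m p _ _ IHp]; apply: SD => //.
rewrite -mul_mpolyC; apply: SM; first by apply/issymP => s; rewrite /msym mmapC.
by rewrite -['X_[m]]mulr1; apply: SXm.
Qed.

End SymmetricSpan.

(** * Nakayama's lemma by determinants *)

Section CentralCharacter.

Variables (F : fieldType) (d l : nat) (H : degAffHecke F d) (hd : (0 < d)%N).
Variables (q : l.-tuple F) (Hq : cyclotomicQuotient H hd q) (i : d.-tuple F).

Local Notation P := (dah_poly H).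
Local Notation T := (@dah_perm F d H).

Lemma hecke_span : exists (n : nat) (b : 'I_n -> H), forall h,
  exists2 g : 'I_n -> {mpoly F[d]},
  forall k, g k \is symmetric & h = \sum_k P (g k) * b k.
Proof.
pose I := ({ffun 'I_d -> 'I_d} * 'S_d)%type.
exists #|{: I}|, (fun k =>
  let aw := enum_val k : I in P (small_monomial F aw.1) * T aw.2).
move=> h; have [f ->] := dah_comb_surj h.
have /fin_all_exists2[g gs gE] := fun w => symmetric_span (f w) hd.
exists (fun k => let aw := enum_val k : I in g aw.2 aw.1) => [k|];
  first exact: gs.
rewrite -(big_enum_val (fun aw : I =>
  P (g aw.2 aw.1) * (P (small_monomial F aw.1) * T aw.2))) /=.
rewrite (eq_bigl xpredT) // -(pair_bigA _ (fun a w =>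
  P (g w a) * (P (small_monomial F a) * T w))) /=.
rewrite exchange_big; apply: eq_bigr => w _ /=.
rewrite {1}gE rmorph_sum mulr_suml; apply: eq_bigr => a _.
by rewrite rmorphM mulrA.
Qed.

(** The preimage in [H] of the ideal of [Hq] generated by the symmetric polynomials that vanish at
    [i]. *)
Definition char_ideal (h : H) : Prop :=
  exists s : seq ({mpoly F[d]} * H),
    (forall g, g \in s -> g.1 \is symmetric /\ g.1.@[tnth i] = 0) /\
    cq_proj Hq h = cq_proj Hq (\sum_(g <- s) P g.1 * g.2).

(** Otherwise the spanning family satisfies b = N b in the quotient, where [N] has symmetric entries
    vanishing at [i]. Then det(1 - N) is 0 in the quotient but has value 1 at [i], against the
    factorisation of chi(i). *)
Lemma char_ideal_proper (phi : Hq -> F) :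
  center_hom phi -> (forall z : H, central z -> chi i z (phi (cq_proj Hq z))) ->
  ~ char_ideal 1.
Proof.
move=> [phi1 phiD phiM phiZ] phi_chi [s [sP s1]].
have [n [b bP]] := hecke_span.
have [N NP] : exists N : 'M[{mpoly F[d]}]_n,
   forall k, (forall m, N k m \is symmetric /\ (N k m).@[tnth i] = 0) /\
     cq_proj Hq (b k) = cq_proj Hq (\sum_m P (N k m) * b m).
  have /fin_all_exists[N NP] : forall k, exists r : 'I_n -> {mpoly F[d]},
     (forall m, r m \is symmetric /\ (r m).@[tnth i] = 0) /\
     cq_proj Hq (b k) = cq_proj Hq (\sum_m P (r m) * b m).
    move=> k; have -> : cq_proj Hq (b k) =
      cq_proj Hq (\sum_(g <- s) P g.1 * (g.2 * b k)).
      rewrite -[in LHS](mul1r (b k)) rmorphM s1 -rmorphM mulr_suml;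
        congr (cq_proj Hq _).
      by apply: eq_bigr => g _; rewrite mulrA.
    elim: s sP {s1} => [|g s IHs] sP.
      exists (fun=> 0); split=> [m|]; first by rewrite rpred0 meval0.
      by rewrite big_nil big1 // => m _; rewrite rmorph0 mul0r.
    have [|r [r1 r2]] := IHs; first by move=> g' gs; apply: sP;
      rewrite inE gs orbT.
    have [gs g0] := sP g (mem_head _ _).
    have [c cs cE] := bP (g.2 * b k).
    exists (fun m => g.1 * c m + r m); split=> [m|].
      have [? r0] := r1 m.
      by rewrite rpredD ?rpredM // mevalD mevalM g0 r0 mul0r addr0.
    rewrite big_cons rmorphD r2 -rmorphD cE mulr_sumr -big_split /=;
      congr (cq_proj Hq _).
    by apply: eq_bigr => m _; rewrite rmorphD rmorphM mulrDl mulrA.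
  exists (\matrix_(k, m) N k m) => k; split=> [m|]; first by rewrite mxE;
    apply: (NP k).1.
  by rewrite (NP k).2; congr (cq_proj Hq _); apply: eq_bigr => m _; rewrite mxE.
pose A := 1%:M - N.
have Ab k : cq_proj Hq (\sum_m P (A k m) * b m) = 0.
  rewrite [X in cq_proj Hq X](_ : _ = b k - \sum_m P (N k m) * b m).
    by rewrite rmorphB {1}(NP k).2 subrr.
  rewrite (eq_bigr (fun m => P (1%:M k m) * b m - P (N k m) * b m)); last first.
    by move=> m _; rewrite !mxE rmorphB mulrBl.
  rewrite sumrB (bigD1 k) //= mxE eqxx rmorph1 mul1r big1 ?addr0 // => m.
  by rewrite eq_sym mxE => /negPf ->; rewrite rmorph0 mul0r.
have Asym k m : A k m \is symmetric.
  by rewrite !mxE rpredB //; [case: (k == m);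
    rewrite ?rpred1 ?rpred0|case: ((NP k).1 m)].
(* Multiplication by the adjugate isolates the determinant. *)
have detb k : cq_proj Hq (P (\det A) * b k) = 0.
  have E : P (\det A) * b k = \sum_j P ((\adj A) k j) * \sum_m P (A j m) * b m.
    transitivity (\sum_m P ((\adj A *m A) k m) * b m).
      rewrite mul_adj_mx (bigD1 k) //= mxE eqxx big1 ?addr0 // => m.
      by rewrite eq_sym mxE => /negPf ->; rewrite rmorph0 mul0r.
    under [RHS]eq_bigr do rewrite mulr_sumr.
    rewrite exchange_big; apply: eq_bigr => m _ /=.
    rewrite mxE rmorph_sum mulr_suml; apply: eq_bigr => j _.
    by rewrite rmorphM mulrA.
  by rewrite E rmorph_sum big1 // => j _; rewrite rmorphM Ab mulr0.
have det_sym : \det A \is symmetric.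
  rewrite rpred_sum // => s' _; rewrite rpredM //; last by rewrite rpred_prod.
  by rewrite rpredX // rpredN rpred1.
have det0 : cq_proj Hq (P (\det A)) = 0.
  have [c cs c1] := bP 1.
  rewrite -[P _]mulr1 c1 mulr_sumr rmorph_sum big1 // => k _.
  have C := @dah_sym_central _ _ H _ (cs k) (P (\det A)).
  by rewrite mulrA -C -mulrA rmorphM detb mulr0.
have det1 : (\det A).@[tnth i] = 1.
  rewrite -det_map_mx (_ : map_mx _ A = 1%:M) ?det1 //.
  apply/matrixP => k m; rewrite mxE;
    have -> : A k m = 1%:M k m - N k m by rewrite !mxE.
  rewrite rmorphB /= ((NP k).1 m).2 subr0 !mxE.
  by case: (k == m); rewrite ?meval1 ?meval0.
have := phi_chi _ (@dah_sym_central _ _ H _ det_sym);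
  rewrite det0 => -[g gs [/dah_poly_inj <-]].
rewrite det1 => phi0.
have c0 : central (0 : Hq) by move=> y; rewrite mul0r mulr0.
by have /eqP := phiD 0 0 c0 c0;
  rewrite addr0 phi0 eq_sym -subr_eq0 addrK oner_eq0.
Qed.

End CentralCharacter.

(** * From a factoring character to a multipartition *)

Lemma sym_meval_perm_eq (F : fieldType) (d : nat) (i j : d.-tuple F) :
  (forall g : {mpoly F[d]}, g \is symmetric -> g.@[tnth i] = g.@[tnth j]) ->
  perm_eq i j.
Proof.
move=> ij; apply: prod_XsubC_eq.
have E (k : d.-tuple F) : \prod_(x <- k) ('X - x%:P) =
    map_poly (meval (tnth k)) (generic_poly F d).
  rewrite big_tuple rmorph_prod; apply: eq_bigr => a _.
  by rewrite rmorphB /= map_polyX map_polyC /= mevalXU.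
rewrite !E; apply/polyP => a; rewrite !coef_map /=.
exact/ij/generic_poly_sym.
Qed.

Lemma meval_perm_eq (F : fieldType) (d : nat) (i j : d.-tuple F)
  (g : {mpoly F[d]}) :
  perm_eq i j -> g \is symmetric -> g.@[tnth i] = g.@[tnth j].
Proof.
move=> /tuple_permP[s /val_inj ->] /issymP gs; rewrite -{1}(gs (s^-1)%g).
elim/mpoly_alg_ind: g {gs} => [c|k|p r IHp IHr|p r IHp IHr].
- by rewrite /msym mmapC !mevalC.
- by rewrite msymXi !mevalXU tnth_mktuple permKV.
- by rewrite msymD !mevalD IHp IHr.
- by rewrite msymM !mevalM IHp IHr.
Qed.

(** On the nonzero module [H / I] the centre acts through [i] and the cyclotomic polynomial by 0. On
    a weight vector a symmetric polynomial acts both by its value at [i] and by its value at the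
    residues, so the two tuples agree up to order. *)
Lemma factor_residues (F : fieldType) (d l : nat) (H : degAffHecke F d)
    (hd : (0 < d)%N) (q : l.-tuple F) (Hq : cyclotomicQuotient H hd q)
    (i : d.-tuple F) (phi : Hq -> F) :
  center_hom phi ->
  (forall z : H, central z -> chi i z (phi (cq_proj Hq z))) ->
  exists lam : multipartition l d, perm_eq i (mresidues q lam).
Proof.
case: d => [//|d] in H hd Hq i phi * => phi_hom phi_chi.
pose I := char_ideal Hq i.
have I1 : ~ I 1 := char_ideal_proper phi_hom phi_chi.
have IP g h : g \is symmetric -> g.@[tnth i] = 0 -> I (dah_poly H g * h).
  move=> gs g0; exists [:: (g, h)]; rewrite big_seq1;
    split=> // _ /[!inE] /eqP -> //.
have I0 h : cq_proj Hq h = 0 -> I h.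
  by move=> h0; exists [::]; rewrite big_nil h0 rmorph0.
have [V [p [pM pS pI]]] : exists (V : lmodType H) (p : H -> V),
   [/\ forall h a, p (h * a) = h *: p a, forall v, exists a, v = p a
    & forall a, p a = 0 <-> I a].
  apply: left_ideal_quotient.
  - by apply: I0; rewrite rmorph0.
  - move=> a b [s [sP aE]] [t [tP bE]];
    exists (s ++ [seq (g.1, - g.2) | g <- t]); split.
      move=> g; rewrite mem_cat => /orP[/sP//|/mapP[g' /tP ? ->] //].
    rewrite rmorphB aE bE -rmorphB big_cat big_map -sumrN;
      congr (cq_proj Hq (_ + _)).
    by apply: eq_bigr => g _; rewrite mulrN.
  - move=> h a [s [sP aE]]; exists [seq (g.1, h * g.2) | g <- s]; split.
      by move=> _ /mapP[g /sP ? ->].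
    rewrite rmorphM aE -rmorphM big_map mulr_sumr !big_seq;
      congr (cq_proj Hq _).
    apply: eq_bigr => g /sP[gs _].
    by rewrite mulrA -(dah_sym_central gs) mulrA.
have scalar g (v : V) : g \is symmetric -> dah_poly H g *: v =
  (g.@[tnth i])%:A *: v.
  move=> gs; have [a ->] := pS v; apply/eqP; rewrite -subr_eq0 -scalerBl -pM.
  have -> : dah_poly H g - (g.@[tnth i])%:A =
    dah_poly H (g - (g.@[tnth i])%:MP).
    by rewrite rmorphB /= dah_polyC.
  apply/eqP/pI/IP; last by rewrite mevalB mevalC subrr.
  by rewrite rpredB //; apply/issymP => s; rewrite /msym mmapC.
have kill (v : V) : hprod q (hx H 0) v = 0.
  have -> : hprod q (hx H 0) v = dah_poly H (cyclotomic_poly hd q) *: v.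
    have -> : dah_poly H (cyclotomic_poly hd q) =
      \prod_(a <- q) (hx H 0 - a%:A).
      rewrite big_tuple rmorph_prod; apply: eq_bigr => r _.
      rewrite rmorphB /= dah_polyC /hx; congr (dah_poly H 'X_ _ - _).
      by apply: val_inj; rewrite /= inordK.
    rewrite /hprod; elim: (tval q) => [|a s IHs] /=;
      first by rewrite big_nil scale1r.
    by rewrite IHs big_cons scalerA.
  have [a ->] := pS v; rewrite -pM; apply/pI/I0; apply/cq_proj_ker.
  by exists [:: (1, a)]; rewrite big_seq1 mul1r.
have [] := @weight_exists _ _ H V q 0 (fun=> True) => //.
  exists (p 1) => //; apply/eqP => /pI; exact: I1.
rewrite subn0 => lam [slam lamP sR [v [_ v0 vR]]].
have slam' : size lam == l by rewrite slam size_tuple.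
pose L := Tuple slam'.
have RE : flatten [seq residues p.1 p.2 | p <- zip q lam] = mresidues q L.
  rewrite /mresidues; congr flatten.
  apply: (@eq_from_nth _ [::]) => [|r].
    by rewrite size_map size_zip slam minnn size_map size_enum_ord size_tuple.
  rewrite size_map size_zip slam minnn size_tuple => rl.
  rewrite (nth_map (0, [::])) ?size_zip ?slam ?minnn ?size_tuple // nth_zip //=.
  rewrite (nth_map (Ordinal rl)) ?size_enum_ord // !(tnth_nth 0) (tnth_nth
    [::]).
  by rewrite nth_enum_ord.
have Lpart r : is_partition (tnth L r) by apply: (allP lamP); apply: mem_tnth.
have Lsize : (\sum_(r < l) sumn (tnth L r) = d.+1)%N.
  rewrite -sR RE size_flatten /shape -map_comp sumnE big_map big_enum /=.
  by apply: eq_bigr => r _; rewrite size_residues.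
exists (Multipartition Lpart Lsize) => /=.
have sR' : size (mresidues q L) == d.+1 by rewrite -RE sR.
apply: (@sym_meval_perm_eq _ _ i (Tuple sR')) => g gs.
apply/eqP; rewrite -subr_eq0; apply/eqP; apply: (@sc_eq0 _ _ H V _ v) => //.
rewrite -scB -scalar //; apply/eqP; rewrite subr_eq0; apply/eqP.
elim/mpoly_alg_ind: g {gs} => [c|k|g1 g2 IH1 IH2|g1 g2 IH1 IH2].
- by rewrite mevalC dah_polyC.
- rewrite mevalXU (tnth_nth 0) /= -RE -vR // add0n; congr (_ *: _).
  by rewrite /hx inord_val.
- by rewrite rmorphD mevalD scalerDl IH1 IH2 scalerDl scalerDl.
- by rewrite rmorphM mevalM -scalerA IH2 scC IH1 scalerA mulr_algl scalerA
  mulrC.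
Qed.

(** * Representations given by operators *)

Section PolynomialOperators.

Variables (F : fieldType) (d : nat) (A : algType F) (X : 'I_d -> A).
Hypothesis XC : forall i j, X i * X j = X j * X i.

Lemma mmap1_comm (m n : 'X_{1..d}) : mmap1 X (m + n) = mmap1 X m * mmap1 X n.
Proof.
rewrite /mmap1 -prodrM_comm => [|i j _ _]; last first.
  exact/commrX/commr_sym/commrX/XC.
by apply: eq_bigr => i _; rewrite mnmDE exprD.
Qed.

Fact mmap_comm_linear : linear (mmap (in_alg A) X).
Proof. by move=> c p r; rewrite mmapD mmapZ /= mulr_algl. Qed.

Fact mmap_comm_monoid : monoid_morphism (mmap (in_alg A) X).
Proof.
split; first by rewrite mmapC /= scale1r.
have P0 : mmap (in_alg A) X 0 = 0 := mmap0 _ _.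
elim/mpolyind=> [|c m p _ _ IHp] r; first by rewrite mul0r P0 mul0r.
rewrite mulrDl !mmapD mulrDl IHp; congr (_ + _).
rewrite -scalerAl !mmapZ -mulrA; congr (_ * _).
elim/mpolyind: r => [|b n r _ _ IHr]; first by rewrite mulr0 P0 mulr0.
rewrite mulrDr !mmapD mulrDr IHr; congr (_ + _).
by rewrite -scalerAr !mmapZ /= !mulr_algl -scalerAr -mpolyXD !mmapX mmap1_comm.
Qed.

Lemma mpoly_operator : exists P : {lrmorphism {mpoly F[d]} -> A},
  forall k, P 'X_k = X k.
Proof.
pose lin := GRing.isLinear.Build _ _ _ _ _ mmap_comm_linear.
pose mon := GRing.isMonoidMorphism.Build _ _ _ mmap_comm_monoid.
pose P : {lrmorphism {mpoly F[d]} -> A} := HB.pack (mmap (in_alg A) X) lin mon.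
by exists P => k; rewrite /= mmapX mmap1U.
Qed.

End PolynomialOperators.

Section HeckeOperators.

Variables (F : fieldType) (d : nat) (H : degAffHecke F d) (A : algType F).
Variables (X : 'I_d -> A) (S : 'S_d -> A).
Hypothesis XC : forall i j, X i * X j = X j * X i.
Hypothesis S1 : S 1%g = 1.
Hypothesis SM : forall s t, S (s * t)%g = S s * S t.
Hypothesis SX : forall i j : 'I_d, j = i.+1 :> nat ->
  S (tperm i j) * X j = X i * S (tperm i j) + 1.
Hypothesis SXfar : forall i j k : 'I_d, j = i.+1 :> nat -> k != i -> k != j ->
  S (tperm i j) * X k = X k * S (tperm i j).

Local Notation P := (dah_poly H).
Local Notation T := (@dah_perm F d H).

(** The basis forces [P p * T w] to act by [Q p * S w]. Multiplicativity is checked for polynomials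
    and simple reflections on the left, where the same divided difference appears in [H] and in
    [A]. *)
Lemma hecke_operator : exists rho : {lrmorphism H -> A},
  (forall k, rho (P 'X_k) = X k) /\ (forall w, rho (T w) = S w).
Proof.
have [Q QX] := mpoly_operator XC.
have [g fK gK] := dah_basis H.
pose rho h := \sum_w Q (g h w) * S w.
have rho_comb f : rho (dah_comb H f) = \sum_w Q (f w) * S w.
  by rewrite /rho /dah_comb fK.
have rhoPT p w : rho (P p * T w) = Q p * S w.
  rewrite -dah_comb_single rho_comb (bigD1 w) //= ffunE eqxx big1 ?addr0 //.
  by move=> u /negPf uw; rewrite ffunE uw rmorph0 mul0r.
have rho_lin : linear rho.
  move=> c z z'; have [f ->] := dah_comb_surj z;
    have [f' ->] := dah_comb_surj z'.
  have -> : c *: dah_comb H f + dah_comb H f' = dah_comb H (c *: f + f').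
    rewrite dah_combD; congr (_ + _); rewrite scaler_sumr;
      apply: eq_bigr => w _.
    by rewrite ffunE linearZ scalerAl.
  rewrite !rho_comb scaler_sumr -big_split; apply: eq_bigr => w _.
  by rewrite !ffunE linearP mulrDl scalerAl.
have rhoD z z' : rho (z + z') = rho z + rho z'.
  by have := rho_lin 1 z z'; rewrite !scale1r.
have rhoP p h : rho (P p * h) = Q p * rho h.
  elim/(@dah_ind _ _ H): h => [z z' IH IH'|r w];
    first by rewrite mulrDr !rhoD mulrDr IH IH'.
  by rewrite mulrA -rmorphM !rhoPT rmorphM mulrA.
have SXinv (i j : 'I_d) : j = i.+1 :> nat ->
    S (tperm i j) * X i = X j * S (tperm i j) - 1.
  by move=> ij; apply: transposition_flip; rewrite ?SX // -SM tperm2 S1.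
have QC c : Q c%:MP = c%:A by rewrite -alg_mpolyC linearZ rmorph1.
have rhoS (i j : 'I_d) h : j = i.+1 :> nat ->
    rho (T (tperm i j) * h) = S (tperm i j) * rho h.
  move=> ij; elim/(@dah_ind _ _ H): h => [z z' IH IH'|p w].
    by rewrite mulrDr !rhoD mulrDr IH IH'.
  have [[r rE] /(_ r rE) sp] := dah_tperm_poly H p ij.
  have [|||||_ /(_ r rE) Sp] := @transposition_poly F d A Q (S (tperm i j)) i
    j _ _ _ _ _ p.
  - by apply/eqP => e; move: ij; rewrite e; lia.
  - by move=> c; rewrite /= QC mulr_algl mulr_algr.
  - by rewrite /= !QX SX.
  - by rewrite /= !QX SXinv.
  - by move=> k ki kj; rewrite /= QX SXfar.
  rewrite mulrA sp mulrDl -mulrA -dah_permM rhoD !rhoPT.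
  by rewrite [RHS]mulrA Sp mulrDl -mulrA -SM.
have rhoT w h : rho (T w * h) = S w * rho h.
  elim/adjacent_perm_ind: w h => [|i j w ij IH] h;
    first by rewrite dah_perm1 S1 !mul1r.
  by rewrite dah_permM SM -!mulrA rhoS // IH.
have rho1 : rho 1 = 1.
  by rewrite -(dah_perm1 H) -[T 1%g]mul1r -(rmorph1 P) rhoPT rmorph1 mul1r S1.
have rho_mon : monoid_morphism rho.
  split=> // h h'; elim/(@dah_ind _ _ H): h => [z z' IH IH'|p w].
    by rewrite mulrDl !rhoD mulrDl IH IH'.
  by rewrite -mulrA rhoP rhoT rhoPT mulrA.
pose lin := GRing.isLinear.Build _ _ _ _ _ rho_lin.
pose mon := GRing.isMonoidMorphism.Build _ _ _ rho_mon.
pose R : {lrmorphism H -> A} := HB.pack rho lin mon.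
exists R; split=> [k|w] /=.
  by rewrite -[P _]mulr1 rhoP rho1 mulr1 QX.
by rewrite -[T w]mulr1 rhoT rho1 mulr1.
Qed.

End HeckeOperators.

(** * Modules of tabloids *)

Section EndAlgebra.

Variables (F : fieldType) (vT : vectType F) (vT_proper : (0 < dim vT)%N).

(* MathComp's [lfun_algType] has the opposite product: [f * g] is [g \o f].   *)
Let R := lfun_comp_nzRingType vT_proper.
Let L : lalgType F := HB.pack 'End(vT) R
  (GRing.Lmodule_isLalgebra.Build F R (fun k x y =>
    @comp_lfunZl F _ _ _ k x y)).
Definition lfun_comp_algType : algType F := HB.pack 'End(vT) L
  (GRing.Lalgebra_isAlgebra.Build F L (fun k x y =>
    @comp_lfunZr F _ _ _ k x y)).

End EndAlgebra.

Section Commutator.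

Variable R : pzRingType.
Implicit Types a b e : R.

Definition rcomm a b := a * b - b * a.

Lemma rcommBl a b e : rcomm (a - b) e = rcomm a e - rcomm b e.
Proof. by rewrite /rcomm mulrBl mulrBr !opprB [LHS]addrACA [RHS]addrACA (addrC
  (- _)). Qed.

Lemma rcommBr a b e : rcomm e (a - b) = rcomm e a - rcomm e b.
Proof. by rewrite /rcomm mulrBl mulrBr !opprB [LHS]addrACA [RHS]addrACA (addrC
  (- _)). Qed.

Lemma rcommDl a b e : rcomm (a + b) e = rcomm a e + rcomm b e.
Proof. by rewrite /rcomm mulrDl mulrDr opprD addrACA. Qed.

Lemma rcommDr a b e : rcomm e (a + b) = rcomm e a + rcomm e b.
Proof. by rewrite /rcomm mulrDl mulrDr opprD addrACA. Qed.

Lemma rcomm_suml (I : finType) (Q : pred I) (f : I -> R) b :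
  rcomm (\sum_(i | Q i) f i) b = \sum_(i | Q i) rcomm (f i) b.
Proof. by rewrite /rcomm mulr_sumr mulr_suml -sumrB. Qed.

Lemma rcomm_sumr (I : finType) (Q : pred I) (f : I -> R) b :
  rcomm b (\sum_(i | Q i) f i) = \sum_(i | Q i) rcomm b (f i).
Proof. by rewrite /rcomm mulr_sumr mulr_suml -sumrB. Qed.

Lemma rcomm0 a b : a * b = b * a -> rcomm a b = 0.
Proof. by rewrite /rcomm => ->; rewrite subrr. Qed.

End Commutator.

Section Tabloids.

Variables (F : fieldType) (d : nat) (J : finType) (j0 : J).

(** A tabloid is the map from entries to their rows. All row lengths are allowed, so functions on
    tabloids form the sum of the permutation modules of all shapes. *)
Definition tabloid := {ffun 'I_d -> J}.

Definition tact (t : tabloid) (p : 'S_d) : tabloid := [ffun x => t (p x)].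

Lemma tactM t p p' : tact (tact t p) p' = tact t (p' * p)%g.
Proof. by apply/ffunP => x; rewrite !ffunE permM. Qed.

Lemma tactE t p x : tact t p x = t (p x).
Proof. exact: ffunE. Qed.

Lemma tact1 t : tact t 1 = t.
Proof. by apply/ffunP => x; rewrite ffunE perm1. Qed.

Definition tspace := {ffun tabloid -> F^o}.

Lemma tspace_proper : (0 < dim tspace)%N.
Proof.
rewrite lt0n -dimvf dimv_eq0; apply/eqP => V0.
have : [ffun=> 1] \in (fullv : {vspace tspace}) by apply: memvf.
rewrite V0 memv0 => /eqP/ffunP/(_ [ffun=> j0]).
by rewrite !ffunE => /eqP; rewrite oner_eq0.
Qed.

Definition tend : algType F := lfun_comp_algType tspace_proper.

Definition tapp (a : tend) (f : tspace) : tspace := (a : 'End(tspace)) f.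

Lemma tappM a b f : tapp (a * b) f = tapp a (tapp b f).
Proof. exact: comp_lfunE. Qed.
Lemma tappD a b f : tapp (a + b) f = tapp a f + tapp b f.
Proof. exact: add_lfunE. Qed.
Lemma tappN a f : tapp (- a) f = - tapp a f.
Proof. exact: opp_lfunE. Qed.
Lemma tappZ c a f : tapp (c *: a) f = c *: tapp a f.
Proof. exact: scale_lfunE. Qed.
Lemma tapp1 f : tapp 1 f = f.
Proof. exact: id_lfunE. Qed.
Lemma tapp0 f : tapp 0 f = 0.
Proof. exact: zero_lfunE. Qed.
Lemma tapp_linear a : linear (tapp a).
Proof. exact: linearP. Qed.
HB.instance Definition _ a := GRing.isLinear.Build F tspace tspace _ (tapp a)
  (tapp_linear a).
Lemma tappP (a b : tend) : (forall f t, tapp a f t = tapp b f t) -> a = b.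
Proof. by move=> ab; apply/lfunP => f; apply/ffunP => t; apply: ab. Qed.

Definition wcomp_fun (k : tabloid -> F) (phi : tabloid -> tabloid) (f :
  tspace) : tspace :=
  [ffun t => k t * f (phi t)].

Fact wcomp_linear k phi : linear (wcomp_fun k phi).
Proof.
move=> a f g; apply/ffunP => t; rewrite !ffunE.
by rewrite mulrDr; congr (_ + _); exact: mulrCA.
Qed.
HB.instance Definition _ k phi :=
  GRing.isLinear.Build F tspace tspace _ (wcomp_fun k phi) (wcomp_linear k phi).

Definition wcomp k phi : tend := linfun (wcomp_fun k phi).

Lemma wcompE k phi f t : tapp (wcomp k phi) f t = k t * f (phi t).
Proof. by rewrite /tapp /wcomp lfunE ffunE. Qed.

Definition tperm_op (w : 'S_d) : tend := wcomp (fun=> 1) (fun t => tact t w^-1).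

Lemma tperm_opE w f t : tapp (tperm_op w) f t = f (tact t w^-1).
Proof. by rewrite wcompE mul1r. Qed.

Lemma tperm_op1 : tperm_op 1 = 1.
Proof. by apply: tappP => f t; rewrite tapp1 tperm_opE invg1 tact1. Qed.

Lemma tperm_opM s p : tperm_op (s * p)%g = tperm_op s * tperm_op p.
Proof. by apply: tappP => f t; rewrite tappM !tperm_opE tactM invMg. Qed.

Variables (lev : J -> nat) (c : J -> F).
Hypothesis lev_c : forall a b, lev a = lev b -> c a = c b.

Definition diag_op k : tend := wcomp (fun t => c (t k)) id.
Definition swap_op k y : tend :=
  wcomp (fun t => (lev (t k) < lev (t y))%N%:R) (fun t => tact t (tperm k y)).

Lemma diag_opE k f t : tapp (diag_op k) f t = c (t k) * f t.
Proof. exact: wcompE. Qed.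

Lemma swap_opE k y f t : tapp (swap_op k y) f t =
  (lev (t k) < lev (t y))%N%:R * f (tact t (tperm k y)).
Proof. exact: wcompE. Qed.

(* [tX] makes [tspace] the [H_d]-module induced from the Young subalgebra of  *)
(* the blocks [{k | lev (t k) = n}], ordered by [lev]; [c] is the value of    *)
(* [x_1] on a block.                                                          *)
Definition tY k : tend := diag_op k - \sum_y swap_op k y.
(** The Jucys-Murphy element, to be added to the operators [tY], which ['S_d] permutes by
    conjugation. *)
Definition tL (k : 'I_d) : tend := \sum_(y < d | (y < k)%N) tperm_op (tperm y
  k).
Definition tX k : tend := tY k + tL k.

Lemma tperm_swap w k y : tperm_op w * swap_op (w k) (w y) =
  swap_op k y * tperm_op w.
Proof.
apply: tappP => f t; rewrite !tappM tperm_opE !swap_opE tperm_opE !ffunE !permK.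
rewrite !tactM; congr (_ * f (tact _ _)).
by rewrite -tpermJ /conjg -!mulgA mulgV mulg1.
Qed.

Lemma tperm_diag w k : tperm_op w * diag_op (w k) = diag_op k * tperm_op w.
Proof.
by apply: tappP => f t;
  rewrite !tappM tperm_opE !diag_opE tperm_opE !ffunE !permK.
Qed.

Lemma tperm_Y w k : tperm_op w * tY (w k) = tY k * tperm_op w.
Proof.
rewrite mulrBr mulrBl tperm_diag; congr (_ - _).
rewrite (reindex_inj (@perm_inj _ w)) mulr_sumr mulr_suml;
  apply: eq_bigr => y _.
exact: tperm_swap.
Qed.

Lemma tpermY k y m : m != k -> m != y -> tperm_op (tperm k y) * tY m =
  tY m * tperm_op (tperm k y).
Proof. by move=> mk my; rewrite -tperm_Y tpermD // eq_sym. Qed.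

Lemma tappDE a b f t : tapp (a + b) f t = tapp a f t + tapp b f t.
Proof. by rewrite tappD ffunE. Qed.

Lemma tappNE a f t : tapp (- a) f t = - tapp a f t.
Proof. by rewrite tappN ffunE. Qed.

Let opE := (tappM, tappDE, tappNE, diag_opE, swap_opE, tperm_opE, tactM, tactE).

Lemma swap_op_pair k m : k != m ->
  let B k m := diag_op k - swap_op k m in
  B k m * B m k - B m k * B k m = (B m k - B k m) * tperm_op (tperm k m).
Proof.
move=> km B; apply: tappP => f t; rewrite /B !opE !tpermV (tpermC m k).
rewrite !(tpermL, tpermR) !tperm2 tact1.
have E (a b g h : F) (la lb : nat) : (la = lb -> a = b) ->
    a * (b * h - (lb < la)%N%:R * g) - (la < lb)%N%:R * (a * g - (la <
      lb)%N%:R * h) -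
    (b * (a * h - (la < lb)%N%:R * g) - (lb < la)%N%:R * (b * g - (lb <
      la)%N%:R * h)) =
    b * g - (lb < la)%N%:R * h - (a * g - (la < lb)%N%:R * h).
  by case: ltngtP => [_ _|_ _|e /(_ (esym e)) ->] /=; ring.
exact: E (@lev_c (t k) (t m)).
Qed.

(** All products reduce to the same two 3-cycles; what is left is an identity for each order of the
    three levels. *)
Lemma swap_op_triple k m y : k != m -> k != y -> m != y ->
  (swap_op k m * swap_op m y - swap_op m y * swap_op k m) +
  (swap_op k y * swap_op m k - swap_op m k * swap_op k y) +
  (swap_op k y * swap_op m y - swap_op m y * swap_op k y) =
  (swap_op k y - swap_op m y) * tperm_op (tperm k m).
Proof.
move=> km ky my; apply: tappP => f t; rewrite !opE !tpermV.
have cyc a b e : a != e -> b != e ->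
    (tperm b e * tperm a b = tperm a b * tperm a e :> 'S_d)%g.
  by move=> ae be; rewrite conjgC tpermJ tpermR tpermD.
have c1 := cyc k m y ky my.
have c2 : (tperm k m * tperm m y = tperm m y * tperm k y)%g.
  by rewrite (tpermC k m) (tpermC m y) cyc 1?eq_sym // (tpermC y k).
have c3 : (tperm k y * tperm k m = tperm m y * tperm k y)%g.
  by rewrite (tpermC m y) (cyc k y m) // eq_sym.
have c4 : (tperm k y * tperm m y = tperm k m * tperm k y)%g.
  by rewrite (tpermC k y) (tpermC m y) -(cyc y k m) // eq_sym.
rewrite (tpermC m k) c1 c2 c3 c4.
have [mk yk ym] : [/\ m != k, y != k & y != m] by split; rewrite eq_sym.
rewrite !(tpermL, tpermR) !(tpermD (x := k) (y := m)) //.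
rewrite !(tpermD (x := m) (y := y)) // !(tpermD (x := k) (y := y)) //.
have E (g h : F) (x z e : nat) :
    (x < z)%N%:R * ((x < e)%N%:R * g) - (z < e)%N%:R * ((x < e)%N%:R * h) +
    ((x < e)%N%:R * ((z < e)%N%:R * g) - (z < x)%N%:R * ((z < e)%N%:R * h)) +
    ((x < e)%N%:R * ((z < x)%N%:R * h) - (z < e)%N%:R * ((x < z)%N%:R * g)) =
    (x < e)%N%:R * g - (z < e)%N%:R * h.
  case: (ltngtP x z) => xz; case: (ltngtP x e) => xe;
    case: (ltngtP z e) => ze /=;
    first [exfalso; lia | ring].
exact: E.
Qed.

Lemma swap_op_far k y m z : k != m -> k != z -> y != m -> y != z ->
  swap_op k y * swap_op m z = swap_op m z * swap_op k y.
Proof.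
move=> km kz ym yz; have [mk zk my zy] : [/\ m != k, z != k, m != y & z != y].
  by split; rewrite eq_sym.
apply: tappP => f t; rewrite !opE !tpermD //.
rewrite [RHS]mulrCA; congr (_ * (_ * f (tact _ _))).
by rewrite conjgC tpermJ !tpermD.
Qed.

Lemma diag_swap k m y : k != m -> k != y ->
  diag_op k * swap_op m y = swap_op m y * diag_op k.
Proof.
move=> km ky; apply: tappP => f t; rewrite !opE tpermD; [|by rewrite eq_sym..].
exact: mulrCA.
Qed.

Lemma swap_op_self k : swap_op k k = 0.
Proof. by apply: tappP => f t; rewrite swap_opE ltnn mul0r tapp0 ffunE. Qed.

(** The pair [k], [m] contributes [swap_op_pair] and each further entry [y] contributes
    [swap_op_triple]; the remaining commutators involve disjoint entries and vanish. *)
Lemma tY_comm k m : k != m ->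
  tY k * tY m - tY m * tY k = (tY m - tY k) * tperm_op (tperm k m).
Proof.
move=> km; have mk : m != k by rewrite eq_sym.
pose Q y := (y != k) && (y != m).
pose B := diag_op k - swap_op k m; pose C := diag_op m - swap_op m k.
have YkE : tY k = B - \sum_(y | Q y) swap_op k y.
  by rewrite /tY (bigD1 k) //= swap_op_self add0r (bigD1 m) //= opprD addrA.
have YmE : tY m = C - \sum_(y | Q y) swap_op m y.
  rewrite /tY (bigD1 m) //= swap_op_self add0r (bigD1 k) //= opprD addrA.
  by congr (_ - _); apply: eq_bigl => y; rewrite andbC.
have BC : rcomm B C = (C - B) * tperm_op (tperm k m) := swap_op_pair km.
set Rk := \sum_(y | _) _ in YkE; set Rm := \sum_(y | _) _ in YmE.
have T1 : rcomm B Rm = - \sum_(y | Q y) rcomm (swap_op k m) (swap_op m y).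
  rewrite rcomm_sumr -sumrN; apply: eq_bigr => y /andP[yk ym].
  by rewrite rcommBl rcomm0 ?sub0r // diag_swap // eq_sym.
have T2 : rcomm Rk C = - \sum_(y | Q y) rcomm (swap_op k y) (swap_op m k).
  rewrite rcomm_suml -sumrN; apply: eq_bigr => y /andP[yk ym].
  by rewrite rcommBr rcomm0 ?sub0r // diag_swap // eq_sym.
have T3 : rcomm Rk Rm = \sum_(y | Q y) rcomm (swap_op k y) (swap_op m y).
  rewrite rcomm_suml; apply: eq_bigr => y /andP[yk ym].
  rewrite rcomm_sumr (bigD1 y) /=; last by rewrite /Q yk.
  rewrite big1 ?addr0 // => z /andP[/andP[zk zm] zy].
  by rewrite rcomm0 // swap_op_far // eq_sym.
have E : \sum_(y | Q y) (rcomm (swap_op k m) (swap_op m y) +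
    rcomm (swap_op k y) (swap_op m k) + rcomm (swap_op k y) (swap_op m y)) =
    (Rk - Rm) * tperm_op (tperm k m).
  rewrite /Rk /Rm -sumrB mulr_suml; apply: eq_bigr => y /andP[yk ym].
  by apply: swap_op_triple; rewrite // eq_sym.
rewrite -/(rcomm _ _) YkE YmE (rcommBl B Rk) !(rcommBr C Rm) BC T1 T2 T3.
have -> : C - Rm - (B - Rk) = (C - B) + (Rk - Rm).
  by rewrite (opprB B Rk) [LHS]addrACA [RHS]addrACA [- Rm - B]addrC.
rewrite (mulrDl (C - B)) -E !big_split /=.
have sumE (V : zmodType) (x a b e : V) : x - - a - (- b - e) = x + (a + b + e).
  by rewrite !opprD !opprK !addrA.
exact: sumE.
Qed.

Lemma tperm_conj (w : 'S_d) y k :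
  tperm_op w * tperm_op (tperm (w y) (w k)) = tperm_op (tperm y k) * tperm_op w.
Proof. by rewrite -!tperm_opM -tpermJ -conjgC. Qed.

Lemma tperm_L (w : 'S_d) k : w k = k ->
  (forall y : 'I_d, (w y < k)%N = (y < k)%N) ->
  tperm_op w * tL k = tL k * tperm_op w.
Proof.
move=> wk wlt; rewrite /tL mulr_sumr mulr_suml [LHS](reindex_inj (@perm_inj _
  w)).
apply: eq_big => [y|y yk]; first by rewrite wlt.
by rewrite -tperm_conj wk.
Qed.

(** For [k < m] the Jucys-Murphy elements commute, [tL k] commutes with [tY m], and the commutator
    of [tY k] and [tL m] cancels that of [tY k] and [tY m]. *)
Lemma tX_comm k m : tX k * tX m = tX m * tX k.
Proof.
wlog lt_km : k m / (k < m)%N.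
  move=> hyp; case: (ltngtP k m) => [|mk|/val_inj -> //]; first exact: hyp.
  by rewrite (hyp m k).
have km : k != m by apply/eqP => e; move: lt_km; rewrite e ltnn.
have LL : rcomm (tL k) (tL m) = 0.
  rewrite rcomm_suml big1 // => y yk; apply: rcomm0; apply: tperm_L.
    by rewrite tpermD //; apply/eqP => e; move: yk lt_km; rewrite e; lia.
  by move=> z; case: tpermP => [->|->|//]; lia.
have LY : rcomm (tL k) (tY m) = 0.
  rewrite rcomm_suml big1 // => y yk; apply/rcomm0/tpermY;
    last by rewrite eq_sym.
  by apply/eqP => e; move: yk lt_km; rewrite e; lia.
have YL : rcomm (tY k) (tL m) = (tY k - tY m) * tperm_op (tperm k m).
  rewrite rcomm_sumr (bigD1 k) //= big1.
    rewrite addr0 /rcomm [RHS]mulrBl; congr (_ - _).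
    by have := tperm_Y (tperm k m) m; rewrite tpermR.
  move=> y /andP[ym yk].
  rewrite rcomm0 //; apply/esym/tpermY => //.
  by rewrite eq_sym.
apply/eqP; rewrite -subr_eq0 -/(rcomm _ _) /tX.
rewrite (rcommDl (tY k) (tL k)) !(rcommDr (tY m) (tL m)) LL LY YL.
rewrite [rcomm (tY k) _]tY_comm //.
by rewrite -(opprB (tY m)) mulNr !addr0 addrN.
Qed.

Lemma tperm_X (i j : 'I_d) : j = i.+1 :> nat ->
  tperm_op (tperm i j) * tX j = tX i * tperm_op (tperm i j) + 1.
Proof.
move=> ij; rewrite /tX mulrDr mulrDl -addrA.
have := tperm_Y (tperm i j) i; rewrite tpermL => ->; congr (_ + _).
rewrite /tL (bigD1 i) /=; last by rewrite ij.
rewrite mulrDr -tperm_opM tperm2 tperm_op1 addrC; congr (_ + _).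
rewrite mulr_sumr mulr_suml; apply: eq_big => [y|y /andP[yj yi]].
  by rewrite ij ltnS ltn_neqAle andbC.
rewrite -(tperm_conj (tperm i j)) tpermL tpermD // 1?eq_sym //.
by apply/eqP => e; move: yj; rewrite e ltnn.
Qed.

Lemma tperm_X_far (i j k : 'I_d) : j = i.+1 :> nat -> k != i -> k != j ->
  tperm_op (tperm i j) * tX k = tX k * tperm_op (tperm i j).
Proof.
move=> ij ki kj; rewrite mulrDr mulrDl tpermY // tperm_L //.
  by rewrite tpermD // eq_sym.
move=> y; move: ki kj; rewrite -!val_eqE /=.
by case: tpermP => [->|->|//]; lia.
Qed.

Lemma tabloid_module (H : degAffHecke F d) : exists rho : {lrmorphism H ->
  tend},
  (forall k, rho (dah_poly H 'X_k) = tX k) /\ (forall w,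
    rho (dah_perm H w) = tperm_op w).
Proof.
apply: hecke_operator.
- exact: tX_comm.
- exact: tperm_op1.
- exact: tperm_opM.
- exact: tperm_X.
- exact: tperm_X_far.
Qed.

End Tabloids.

(** One element of each pair is selected by its rank instead of dividing by 2, so this holds in
    every characteristic. *)
Lemma sum_involution (R : zmodType) (I : finType) (Q : pred I) (f : I -> R)
    (tau : I -> I) :
  (forall x, Q x -> [/\ Q (tau x), tau (tau x) = x, tau x != x
                      & f (tau x) = - f x]) ->
  \sum_(x | Q x) f x = 0.
Proof.
move=> tauP; pose lt x := (enum_rank x < enum_rank (tau x))%N.
rewrite (bigID lt) /= [X in _ + X](reindex_onto tau tau) /=; last first.
  by move=> x /andP[/tauP[]].
rewrite [X in _ + X](eq_big (fun x => Q x && lt x) (fun x => - f x)).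
- by rewrite sumrN subrr.
- move=> x; rewrite /lt; apply/andP/andP => [[/andP[Qt lt1] /eqP tx]|[Qx ltx]].
    have [Qx tt _ _] := tauP _ Qt; rewrite tx in Qx lt1; split=> //.
    rewrite ltn_neqAle leqNgt lt1 andbT; apply/eqP => /val_inj/enum_rank_inj e.
    by have [_ _] := tauP _ Qx; rewrite -e eqxx.
  have [Qt tx _ _] := tauP _ Qx; rewrite tx eqxx Qt /=; split=> //.
  by rewrite -leqNgt ltnW.
- by move=> x /andP[/andP[Qt _] /eqP tx]; have [Qx _ _ _] := tauP _ Qt;
    rewrite tx in Qx; have [] := tauP _ Qx.
Qed.

(** * Column antisymmetrisers *)

Section Delta.

Variables (F : fieldType) (d : nat) (J : finType) (j0 : J).

Local Notation tend := (tend F d j0).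
Local Notation tspace := (tspace F d J).
Local Notation tabloid := (tabloid d J).
Local Notation pi := (tperm_op F j0).
Implicit Types (t u : tabloid) (f : tspace).

Definition delta t : tspace := [ffun u => (u == t)%:R].

Lemma tact_inj (w : 'S_d) : injective (fun t => tact t w).
Proof. by move=> t u /(congr1 (fun v => tact v w^-1));
  rewrite !tactM mulVg !tact1. Qed.

Lemma tperm_delta w t : tapp (pi w) (delta t) = delta (tact t w).
Proof.
apply/ffunP => u; rewrite tperm_opE !ffunE; congr (_ : bool)%:R.
by rewrite -(inj_eq (@tact_inj w)) tactM mulgV tact1.
Qed.

Lemma delta_sum f : f = \sum_t f t *: delta t.
Proof.
apply/ffunP => u; rewrite sum_ffunE (bigD1 u) //= !ffunE eqxx big1 ?addr0.
  exact/esym/mulr1.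
by move=> t /negPf; rewrite !ffunE eq_sym => ->; exact: mulr0.
Qed.

Variables (K : eqType) (kap : 'I_d -> K).

(** The Young subgroup of the fibres of [kap], which will be columns. *)
Definition stab : pred 'S_d := fun s => [forall x, kap (s x) == kap x].

Lemma stabP (s : 'S_d) : reflect (forall x, kap (s x) = kap x) (stab s).
Proof. by apply: (iffP forallP) => h x; apply/eqP. Qed.

Lemma stab1 : stab 1%g.
Proof. by apply/stabP => x; rewrite perm1. Qed.

Lemma stabM s p : stab s -> stab p -> stab (s * p)%g.
Proof. by move=> /stabP hs /stabP hp; apply/stabP => x;
  rewrite permM hp hs. Qed.

Lemma stabV s : stab s -> stab (s^-1)%g.
Proof. by move=> /stabP hs; apply/stabP => x; rewrite -{2}(permKV s x) hs. Qed.

Lemma stab_tperm a b : kap a = kap b -> stab (tperm a b).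
Proof. by move=> ab; apply/stabP => x; case: tpermP => [->|->|//]. Qed.

Lemma stabMr s p : stab p -> stab (s * p)%g = stab s.
Proof.
move=> hp; apply/idP/idP => [h|h]; last exact: stabM.
by rewrite -(mulgK p s); apply: stabM => //; apply: stabV.
Qed.

Lemma stabMl s p : stab p -> stab (p * s)%g = stab s.
Proof.
move=> hp; apply/idP/idP => [h|h]; last exact: stabM.
by rewrite -(mulKg p s); apply: stabM => //; apply: stabV.
Qed.

Definition asym : tend := \sum_(s | stab s) (-1) ^+ s *: pi s.

Lemma asym_tperm p : stab p -> asym * pi p = (-1) ^+ p *: asym.
Proof.
move=> hp; rewrite /asym mulr_suml [RHS]scaler_sumr.
rewrite [RHS](reindex_inj (mulIg p)) /=; apply: eq_big => [s|s _].
  by rewrite stabMr.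
by rewrite -scalerAl -tperm_opM scalerA odd_permM mulrC -signr_addb addbK.
Qed.

Lemma asymE f t : tapp asym f t = \sum_(s | stab s) (-1) ^+ s * f (tact t s^-1).
Proof.
rewrite /asym; have h : {morph (fun a : tend => tapp a f t) : a b / a + b}.
  by move=> a b; rewrite tappDE.
rewrite (big_morph (fun a : tend => tapp a f t) h (_ : _ = 0)); last first.
  by rewrite tapp0 ffunE.
by apply: eq_bigr => s _; rewrite tappZ ffunE tperm_opE.
Qed.

Lemma asym_tact f t p : stab p -> tapp asym f (tact t p) =
  (-1) ^+ p * tapp asym f t.
Proof.
move=> hp; rewrite !asymE mulr_sumr (reindex_inj (mulgI p)) /=.
apply: eq_big => [s|s _]; first by rewrite stabMl.
by rewrite tactM invMg mulgKV odd_permM signr_addb mulrA.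
Qed.

(** [s] and [s * tperm a b] give the same tabloid with opposite signs. *)
Lemma asym_repeat t a b : a != b -> kap a = kap b -> t a = t b ->
  tapp asym (delta t) = 0.
Proof.
move=> ab kab tab; apply/ffunP => u; rewrite ffunE asymE.
apply: (sum_involution (tau := fun s => (s * tperm a b)%g)) => s hs.
have ht := stab_tperm kab; split.
- by rewrite stabMr.
- by rewrite -mulgA tperm2 mulg1.
- rewrite -{2}[s]mulg1 (inj_eq (mulgI s)); apply/eqP => /permP/(_ a).
  by rewrite tpermL perm1 => e; rewrite e eqxx in ab.
rewrite odd_permM odd_tperm ab signr_addb mulrN1 mulNr; congr (- (_ * _)).
rewrite invMg tpermV -tactM !ffunE; congr (_ : bool)%:R.
have tt : tact t (tperm a b) = t.
  by apply/ffunP => x; rewrite tactE; case: tpermP => // ->.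
by rewrite -{1}tt (inj_eq (@tact_inj _)).
Qed.

Lemma asym_delta_neq0 t u :
  tapp asym (delta t) u != 0 -> exists2 s, stab s & u = tact t s.
Proof.
rewrite asymE => /eqP h;
  have [s /andP[hs /eqP us]|none] := pickP (fun s => stab s && (u == tact t s)).
  by exists s.
case: h; apply: big1 => s hs; rewrite ffunE.
have := none s; rewrite hs /= -(inj_eq (@tact_inj s^-1)) tactM mulVg tact1 =>
  ->.
by rewrite mulr0.
Qed.

End Delta.

(** * Polytabloids of a multipartition *)

Section BoxTabloids.

Variables (F : fieldType) (d l N : nat) (q : 'I_l -> F).

Let J := ('I_l * 'I_N)%type.

Variables (j0 : J) (len : J -> nat) (row : 'I_d -> J) (col : 'I_d -> nat).
Hypothesis box_inj : forall a b, row a = row b -> col a = col b -> a = b.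
Hypothesis len_le : forall (r : 'I_l) (i i' : 'I_N), (i <= i')%N ->
  (len (r, i') <= len (r, i))%N.
Hypothesis col_lt : forall a, (col a < len (row a))%N.
Hypothesis box_ex : forall x j, (j < len x)%N -> exists a,
  row a = x /\ col a = j.

Local Notation tend := (tend F d j0).
Local Notation tspace := (tspace F d J).
Local Notation tabloid := (tabloid d J).
Local Notation pi := (tperm_op F j0).
Implicit Types (t u : tabloid) (f : tspace).

Definition tab0 : tabloid := finfun row.
Definition ccol a := ((row a).1, col a).

Local Notation full := (asym F j0 col).
Local Notation part := (asym F j0 ccol).

(** [efull] antisymmetrises over columns running through all components together and spans the
    rank-one image; [epart] uses the columns of each component separately and generates the module
    induced from the Specht modules. *)
Definition efull : tspace := tapp full (delta F tab0).
Definition epart : tspace := tapp part (delta F tab0).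

(* Two modules on tabloids. For [comp_lev] and [comp_wt], [x_1] acts on the   *)
(* permutation module of the component [r] by [q r], and the cyclotomic       *)
(* polynomial acts by zero. For [row_lev] and [row_wt], the module is induced *)
(* from one-dimensional ones, one for each row of the multipartition, so that *)
(* [delta tab0] is a weight vector. Within a component the last row comes     *)
(* first: this is what makes the two actions agree on [epart].                *)
Definition row_lev (x : J) := (x.1 * N + (N.-1 - x.2))%N.
Definition row_wt (x : J) : F := q x.1 - x.2%:R.
Definition comp_lev (x : J) := val x.1.
Definition comp_wt (x : J) : F := q x.1.

Lemma row_lev_lt x y : (row_lev x < row_lev y)%N =
  ((x.1 < y.1) || ((x.1 == y.1) && (y.2 < x.2)))%N.
Proof.
case: x y => [r i] [r' i']; rewrite /row_lev /= -val_eqE /=.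
have := ltn_ord i; have := ltn_ord i'; have := ltn_ord r; have := ltn_ord r'.
move: (val r) (val r') (val i) (val i') => a b x y _ _ yN xN.
case: (ltngtP a b) => [ab|ab|->] /=; [|nia|lia].
nia.
Qed.

Lemma row_lev_inj : injective row_lev.
Proof.
move=> x y e; have := row_lev_lt x y; have := row_lev_lt y x.
rewrite e ltnn; case: x y {e} => [r i] [r' i'] /=; rewrite -!val_eqE /=.
case: (ltngtP r r') => //= /val_inj ->;
  case: (ltngtP i i') => //= /val_inj -> //.
Qed.

Lemma row_lev_wt x y : row_lev x = row_lev y -> row_wt x = row_wt y.
Proof. by move/row_lev_inj->. Qed.

Lemma comp_lev_wt x y : comp_lev x = comp_lev y -> comp_wt x = comp_wt y.
Proof. by rewrite /comp_wt => /val_inj->. Qed.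

Local Notation rY := (tY j0 row_lev row_wt).
Local Notation rX := (tX j0 row_lev row_wt).
Local Notation cY := (tY j0 comp_lev comp_wt).
Local Notation cX := (tX j0 comp_lev comp_wt).

Lemma tab0E a : tab0 a = row a. Proof. exact: ffunE. Qed.

Lemma tapp_sum (I : finType) (Q : pred I) (a : I -> tend) f t :
  tapp (\sum_(i | Q i) a i) f t = \sum_(i | Q i) tapp (a i) f t.
Proof.
elim/big_rec2: _ => [|i x y _ <-]; first by rewrite tapp0 ffunE.
by rewrite tappDE.
Qed.

Lemma tYE lev c k f t : tapp (tY j0 lev c k) f t =
  c (t k) * f t - \sum_y (lev (t k) < lev (t y))%N%:R * f (tact t (tperm k y)).
Proof.
rewrite /tY tappDE tappNE diag_opE tapp_sum; congr (_ - _).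
by apply: eq_bigr => y _; rewrite swap_opE.
Qed.

Lemma tact_tab0_inj (K : eqType) (kap : 'I_d -> K) (s : 'S_d) a b :
  (forall a b, row a = row b -> kap a = kap b -> a = b) ->
  stab kap s -> tact tab0 s a = tact tab0 s b -> kap a = kap b -> a = b.
Proof.
move=> ki /stabP hs; rewrite !tactE !tab0E => e kab.
by apply: (@perm_inj _ s); apply: ki; rewrite ?hs.
Qed.

Lemma ccol_inj a b : row a = row b -> ccol a = ccol b -> a = b.
Proof. by move=> rab [_ cab]; apply: box_inj. Qed.

Lemma efull_tab0 : efull tab0 = 1.
Proof.
rewrite /efull asymE (bigD1 1%g) ?stab1 //= odd_perm1 invg1 tact1 ffunE eqxx
  mulr1.
rewrite big1 ?addr0 // => s /andP[hs s1]; rewrite ffunE.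
case: eqP => [e|_]; last exact: mulr0.
case/eqP: s1; apply/permP => a; rewrite perm1.
apply: box_inj; last by apply/stabP.
have := congr1 (fun t => tact t s a) e.
by rewrite tactM mulgV tact1 tactE !tab0E.
Qed.

Lemma card_col_le (A : {set 'I_d}) m :
  {in A &, injective col} -> {in A, forall a, (col a < m)%N} -> (#|A| <= m)%N.
Proof.
move=> ci cm; rewrite cardE -(size_map col) -(size_iota 0 m).
apply: uniq_leq_size => [|j /mapP[a]].
  by rewrite map_inj_in_uniq ?enum_uniq // => a b; rewrite !mem_enum; apply: ci.
by rewrite mem_enum mem_iota => /cm ? ->.
Qed.

Lemma card_col_ge (A : {set 'I_d}) m :
  (forall j, (j < m)%N -> exists2 a, a \in A & col a = j) -> (m <= #|A|)%N.
Proof.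
move=> cm; rewrite cardE -(size_map col) -[m in leqLHS](size_iota 0 m).
apply: uniq_leq_size (iota_uniq _ _) _ => j; rewrite mem_iota => /cm[a aA <-].
by apply: map_f; rewrite mem_enum.
Qed.

Lemma sum_fiber_card (g : 'I_d -> J) m :
  (\sum_b #|[set a | (g a == b) && (col a < m)]| = #|[set a | col a < m]|)%N.
Proof.
rewrite -[RHS]sum1_card (partition_big g xpredT) //=; apply: eq_bigr => b _.
by rewrite -sum1_card; apply: eq_bigl => a; rewrite !inE andbC.
Qed.

(* Counting, for each [m], the boxes in the columns [< m]: row [x] meets at   *)
(* most [minn (len x) m] of them in [t], and exactly that many in [tab0].     *)
Lemma column_count (p : 'S_d) x :
  (forall a b, tact tab0 p a = tact tab0 p b -> col a = col b -> a = b) ->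
  (col x < len (tact tab0 p x))%N.
Proof.
move=> ti; set t := tact tab0 p; set m := len (t x).
have fiber b : #|[set a | t a == b]| = #|[set a | row a == b]|.
  rewrite -(card_imset _ (@perm_inj _ p)); apply: eq_card => a; rewrite inE.
  apply/imsetP/idP => [[z]|ra].
    by rewrite inE tactE tab0E => /eqP <- ->.
  by exists (p^-1 a)%g; rewrite ?permKV // inE tactE tab0E permKV.
have row_le b : (len b <= m)%N ->
    [set a | (row a == b) && (col a < m)%N] = [set a | row a == b].
  move=> lem; apply/setP => a; rewrite !inE; case: eqP => //= ra.
  by apply: leq_trans lem; rewrite -ra.
have le b : (#|[set a | (t a == b) && (col a < m)%N]| <=
             #|[set a | (row a == b) && (col a < m)%N]|)%N.
  have [lem|ltm] := leqP (len b) m.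
    rewrite row_le // -fiber; apply/subset_leq_card/subsetP => a.
    by rewrite !inE => /andP[].
  apply: (@leq_trans m).
    apply: card_col_le => [a a'|a]; rewrite !inE => /andP[/eqP ta am] //.
    by move=> /andP[/eqP ta' _]; apply: ti; rewrite ta ta'.
  apply: card_col_ge => j jm; have [a [ra ca]] := box_ex (ltn_trans jm ltm).
  by exists a; rewrite // inE ra eqxx ca.
(* Summed over all rows, both sides of [le] count the boxes in the columns below [m], so [le] on the
   other rows forces the reverse inequality on the row [t x]. *)
have ge : (#|[set a | row a == t x]| <= #|[set a | (t a == t x) && (col a <
  m)%N]|)%N.
  rewrite -(row_le (t x)) //.
  have := etrans (sum_fiber_card row m) (esym (sum_fiber_card t m)).
  rewrite (bigD1 (t x)) //= [in RHS](bigD1 (t x)) //= => e.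
  rewrite -(leq_add2r (\sum_(b | b != t x) #|[set a | (row a == b) && (col a <
    m)]|)%N).
  by rewrite e leq_add2l; apply: leq_sum => b _; apply: le.
have : x \in [set a | t a == t x] by rewrite inE.
suff <- : [set a | (t a == t x) && (col a < m)%N] = [set a | t a == t x].
  by rewrite inE => /andP[].
apply/eqP; rewrite eqEcard fiber ge andbT; apply/subsetP => a.
by rewrite !inE => /andP[].
Qed.

(** Send [x] to the box in the column of [x] and in the row that [x] has in the tabloid; it exists
    by [column_count]. *)
Lemma column_transport (p : 'S_d) :
  (forall a b, tact tab0 p a = tact tab0 p b -> col a = col b -> a = b) ->
  exists2 s, stab col s & tact tab0 p = tact tab0 s.
Proof.
move=> ti.
have /fin_all_exists[g gP] : forall x, exists z,
    row z = tact tab0 p x /\ col z = col x.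
  by move=> x; apply/box_ex/column_count.
have g_inj : injective g.
  by move=> a b e; apply: ti;
    [rewrite -(gP a).1 -(gP b).1 e | rewrite -(gP a).2 -(gP b).2 e].
exists (perm g_inj); first by apply/stabP => x; rewrite permE (gP x).2.
by apply/ffunP => x; rewrite [RHS]tactE permE tab0E (gP x).1.
Qed.

(** James' dichotomy: either two entries share a row and a column, and the image is 0, or the
    tabloid comes from [tab0] by a column permutation, which contributes a sign. *)
Lemma full_orbit (p : 'S_d) : exists a : F,
  tapp full (delta F (tact tab0 p)) = a *: efull.
Proof.
have [inj|] := boolP [forall a, forall b,
   (tact tab0 p a == tact tab0 p b) && (col a == col b) ==> (a == b)].
  have [a b tab cab|s hs ->] := @column_transport p.
    have /forallP/(_ b) := forallP inj a.
    by rewrite tab cab !eqxx => /eqP.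
  by exists ((-1) ^+ s); rewrite -(tperm_delta _ j0) -tappM asym_tperm // tappZ.
case/forallPn => a /forallPn[b];
  rewrite negb_imply => /andP[/andP[/eqP tab /eqP cab] ab].
by exists 0; rewrite scale0r; apply: asym_repeat cab tab.
Qed.

(** The permutation module of the shape of [tab0], inside the sum over all shapes. *)
Definition on_orbit f := forall t, f t != 0 -> exists p, t = tact tab0 p.

Lemma full_on_orbit f : on_orbit f -> exists a : F, tapp full f = a *: efull.
Proof.
move=> fo; have : forall t, exists a : F,
  tapp full (f t *: delta F t) = a *: efull.
  move=> t; rewrite linearZ /=; have [->|/fo[p ->]] := eqVneq (f t) 0.
    by exists 0; rewrite !scale0r.
  by have [a ->] := full_orbit p; exists (f (tact tab0 p) * a); rewrite scalerA.
case/fin_all_exists => a aE; exists (\sum_t a t).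
rewrite scaler_suml -(eq_bigr _ (fun t _ => aE t)) -linear_sum.
by rewrite -delta_sum.
Qed.

Lemma epart_supp t : epart t != 0 -> exists2 s, stab ccol s & t = tact tab0 s.
Proof. exact: asym_delta_neq0. Qed.

Lemma epart_tact t p : stab ccol p -> epart (tact t p) = (-1) ^+ p * epart t.
Proof. exact: asym_tact. Qed.

Lemma stab_ccolE s a : stab ccol s ->
  (row (s a)).1 = (row a).1 /\ col (s a) = col a.
Proof. by move/stabP/(_ a) => [-> ->]. Qed.

Lemma cY_epart k : tapp (cY k) epart = q (row k).1 *: epart -
  \sum_(y | ((row y).1 < (row k).1)%N) tapp (pi (tperm k y)) epart.
Proof.
apply/ffunP => t; rewrite tYE !ffunE sum_ffunE; congr (_ - _).
  have [->|/epart_supp[s hs ->]] := eqVneq (epart t) 0;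
    first by rewrite mulr0 scaler0.
  by rewrite /comp_wt tactE tab0E (stab_ccolE k hs).1.
rewrite [RHS]big_mkcond; apply: eq_bigr => y _; rewrite tperm_opE tpermV.
have [->|/epart_supp[s hs tE]] := eqVneq (epart (tact t (tperm k y))) 0.
  by rewrite mulr0; case: ifP.
have tx x : (t (tperm k y x)).1 = (row x).1.
  by rewrite -tactE tE tactE tab0E (stab_ccolE x hs).1.
have := tx k; have := tx y; rewrite tpermL tpermR /comp_lev => -> ->.
by case: ifP => _; rewrite ?mul1r ?mul0r.
Qed.

(** In the support of [epart] the entries of a column of a component still fill its rows from the
    top, one each. *)
Lemma column_rows_count t k : epart t != 0 ->
  #|[set y | (ccol y == ccol k) && (((t y).1 == (t k).1) && ((t y).2 < (t
    k).2)%N)]|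
  = (t k).2.
Proof.
move=> /epart_supp[s hs ->]; set t' := tact tab0 s.
have [r1 c1] := stab_ccolE k hs.
rewrite -(card_in_imset (f := fun y => (t' y).2)) => [|a b]; last first.
  rewrite !inE => /andP[/eqP ka /andP[/eqP ra _]] /andP[/eqP kb /andP[/eqP rb
    _]] e.
  apply: (tact_tab0_inj ccol_inj hs); last by rewrite ka.
  by rewrite -/t'; move: ra rb e;
    case: (t' a) (t' b) => [? ?] [? ?] /= -> -> ->.
transitivity #|[set i : 'I_N | (i < (t' k).2)%N]|; last first.
  rewrite -sum1_card (eq_bigl (fun i : 'I_N => (i < (t' k).2)%N)) => [|i].
    by rewrite -(big_ord_widen _ (fun=> 1%N)) ?sum1_card ?card_ord // ltnW.
  by rewrite inE.
apply: eq_card => i; rewrite inE; apply/imsetP/idP => [[y]|ik].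
  by rewrite inE => /andP[_ /andP[_ ?]] ->.
have [|z [rz cz]] := @box_ex ((row k).1, i) (col k).
  rewrite -c1; apply: leq_trans (col_lt _) _; rewrite -r1.
  by move: ik; rewrite tactE tab0E; case: (row _) => r i' /= ik;
    apply/len_le/ltnW.
have zk : ccol z = ccol k by rewrite /ccol rz cz.
exists (s^-1 z)%g; last by rewrite tactE permKV tab0E rz.
rewrite inE !tactE permKV !tab0E r1 rz eqxx /=.
move: ik; rewrite tactE tab0E => ->; rewrite andbT.
by rewrite -zk -(stabP _ _ (stabV hs) z).
Qed.

(* The terms with [y] in the column of [k] are counted by [column_rows_count]; *)
(* the others cancel in pairs [y], [w], where [w] is the entry of the column  *)
(* of [y] that gets into the row of [y] (a Garnir-type relation).             *)
Lemma column_exchange t k :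
  \sum_(y | ((t y).1 == (t k).1) && ((t y).2 < (t k).2)%N)
     epart (tact t (tperm k y)) = - ((t k).2%:R * epart t).
Proof.
pose B y := ((t y).1 == (t k).1) && ((t y).2 < (t k).2)%N.
have Bk : ~~ B k by rewrite /B ltnn andbF.
rewrite (bigID (fun y => ccol y == ccol k)) /=.
rewrite [X in _ + X](_ : _ = 0) ?addr0.
  have -> : \sum_(y | B y && (ccol y == ccol k)) epart (tact t (tperm k y)) =
      \sum_(y | B y && (ccol y == ccol k)) (- epart t).
    apply: eq_bigr => y /andP[By /eqP yk].
    rewrite epart_tact ?stab_tperm // odd_tperm.
    have -> : k != y by apply: contraNneq Bk => ->.
    by rewrite expr1 mulN1r.
  have [->|nz] := eqVneq (epart t) 0; first by rewrite mulr0 oppr0 big1.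
  rewrite sumr_const mulNrn -[in LHS]mulr_natl.
  congr (- (_%:R * _)); rewrite -(column_rows_count k nz); apply: eq_card => y.
  by rewrite !inE andbC.
pose f y := epart (tact t (tperm k y)).
pose Q y := [&& B y, ccol y != ccol k & f y != 0].
rewrite (bigID (fun y => f y != 0)) /= [X in _ + X]big1 ?addr0; last first.
  by move=> y /andP[_]; rewrite negbK => /eqP.
rewrite (eq_bigl Q) => [|y]; last by rewrite /Q andbA.
(* Exchanging [y] with its mate is a column permutation, hence changes the sign of [f]. *)
pose mate y w := [&& w != y, ccol w == ccol y & t w == t y].
pose tau y := odflt y [pick w | mate y w].
have nk y w : Q y -> mate y w -> w != k.
  by case/and3P=> _ yk _ /and3P[_ /eqP wy _]; apply: contraNneq yk => <-;
    apply/eqP.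
have mate_uniq y w w' : Q y -> mate y w -> mate y w' -> w = w'.
  move=> Qy mw mw'; have := nk _ _ Qy mw; have := nk _ _ Qy mw'.
  case/and3P: Qy mw mw' => _ _ /epart_supp[s hs tE].
  case/and3P=> wy /eqP cw /eqP tw /and3P[wy' /eqP cw' /eqP tw'] wk' wk.
  apply: (tact_tab0_inj ccol_inj hs); last by rewrite cw.
  by rewrite -tE !tactE !tpermD ?tw // 1?eq_sym.
have mate_ex y : Q y -> exists w, mate y w.
  case/and3P=> By yk /epart_supp[s hs tE].
  have tx x : t (tperm k y x) = row (s x) by rewrite -tactE tE tactE tab0E.
  have := tx y; have := tx k; rewrite tpermL tpermR => ty tk.
  have [ry cy] := stab_ccolE y hs.
  case/andP: By => /eqP r_eq lt_yk.
  (* After the exchange with [k], the entry [y] lies below the row [t y]. Row lengths decrease, so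
     its column has a box in row [t y]; the entry there is the mate. *)
  have [|z [rz cz]] := @box_ex (t y) (col y).
    rewrite -cy; apply: leq_trans (col_lt _) _; rewrite -tk.
    by move: r_eq lt_yk; case: (t y) (t k) => [r i] [r' i'] /= -> ?;
      apply/len_le/ltnW.
  pose w := (s^-1 z)%g; exists w; have sw : s w = z by rewrite permKV.
  have cwy : ccol w = ccol y.
    have [rw cw] := stab_ccolE w hs.
    rewrite /ccol -rw -cw sw rz cz; congr (_, _).
    by rewrite r_eq tk ry.
  have wy : w != y.
    by apply/eqP => e; move: lt_yk; rewrite tk -{2}e sw rz ltnn.
  have wk : w != k by apply: contraNneq yk => <-; rewrite cwy.
  rewrite /mate wy cwy eqxx /=; have := tx w;
    rewrite sw rz tpermD 1?eq_sym // => ->.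
  by rewrite eqxx.
have tauP y : Q y -> mate y (tau y).
  move=> Qy; rewrite /tau; case: pickP => [//|none].
  by have [w mw] := mate_ex y Qy; rewrite none in mw.
have ftau y w : Q y -> mate y w -> f w = - f y.
  move=> Qy mw; have wk := nk _ _ Qy mw; case/and3P: (mw) => wy /eqP cw /eqP tw.
  have yk : y != k by case/and3P: Qy => _ yk _; apply: contraNneq yk => ->.
  have -> : f w = epart (tact (tact t (tperm k y)) (tperm y w)).
    congr (epart _); rewrite tactM; apply/ffunP => x; rewrite !tactE permM.
    have [->|xk] := eqVneq x k.
      by rewrite tpermL [tperm y w k]tpermD // tpermL.
    have [->|xw] := eqVneq x w; first by rewrite !tpermR.
    have [->|xy] := eqVneq x y.
      by rewrite tpermL !tpermD // 1?eq_sym.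
    by rewrite !tpermD // eq_sym.
  rewrite epart_tact; last by apply: stab_tperm.
  by rewrite odd_tperm eq_sym wy expr1 mulN1r.
apply: (sum_involution (tau := tau)) => y Qy.
have my := tauP y Qy; have fy := ftau _ _ Qy my.
have Qt : Q (tau y).
  case/and3P: Qy my fy => By yk nz /and3P[_ /eqP cy /eqP ty] fy.
  by rewrite /Q cy fy oppr_eq0 yk nz !andbT /B ty.
split=> //; last by case/and3P: my.
apply: (mate_uniq (tau y)) => //; first exact: tauP.
by case/and3P: my => a b c; rewrite /mate eq_sym a eq_sym b eq_sym c.
Qed.

(** [row_lev] compares more pairs than [comp_lev], namely those inside a component; by
    [column_exchange] these terms make up for the row index subtracted in [row_wt]. *)
Lemma rY_epart k : tapp (rY k) epart = tapp (cY k) epart.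
Proof.
apply/ffunP => t; rewrite !tYE /row_wt /comp_wt /comp_lev.
under eq_bigr do rewrite row_lev_lt.
rewrite (eq_bigr (fun y =>
  ((t k).1 < (t y).1)%N%:R * epart (tact t (tperm k y)) +
   (if ((t y).1 == (t k).1) && ((t y).2 < (t k).2)%N then epart (tact t (tperm
     k y)) else 0))).
  rewrite big_split /= -(big_mkcond (fun y =>
    ((t y).1 == (t k).1) && ((t y).2 < (t k).2)%N) (fun y =>
    epart (tact t (tperm k y)))) column_exchange mulrBl.
  by rewrite opprD opprK addrACA addNr addr0.
move=> y _; rewrite [(t y).1 == _]eq_sym -!val_eqE /=.
case: ltngtP => _ /=; rewrite ?addr0 // mul0r add0r.
by case: ifP => _; rewrite ?mul1r ?mul0r.
Qed.

Definition in_part f := exists a : 'S_d -> F,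
  f = \sum_w a w *: tapp (pi w) epart.

Lemma in_part0 : in_part 0.
Proof. by exists (fun=> 0); rewrite big1 // => w _; rewrite scale0r. Qed.

Lemma in_partD f g : in_part f -> in_part g -> in_part (f + g).
Proof.
move=> [a ->] [b ->]; exists (fun w => a w + b w).
by rewrite -big_split; apply: eq_bigr => w _; rewrite scalerDl.
Qed.

Lemma in_partZ c f : in_part f -> in_part (c *: f).
Proof.
move=> [a ->]; exists (fun w => c * a w).
by rewrite scaler_sumr; apply: eq_bigr => w _; rewrite scalerA.
Qed.

Lemma in_part_sum (I : Type) (r : seq I) (Q : pred I) (f : I -> tspace) :
  (forall i, Q i -> in_part (f i)) -> in_part (\sum_(i <- r | Q i) f i).
Proof. by move=> h; apply: big_ind => //;
  [apply: in_part0|apply: in_partD]. Qed.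

Lemma in_part_perm w f : in_part f -> in_part (tapp (pi w) f).
Proof.
move=> [a ->]; exists (fun v => a (w^-1 * v)%g).
rewrite linear_sum [RHS](reindex_inj (mulgI w)); apply: eq_bigr => v _.
by rewrite linearZ /= -tappM -tperm_opM mulKg.
Qed.

Lemma in_part_epart : in_part epart.
Proof.
exists (fun w => (w == 1%g)%:R);
  rewrite (bigD1 1%g) //= eqxx scale1r tperm_op1 tapp1.
by rewrite big1 ?addr0 // => w /negPf ->; rewrite scale0r.
Qed.

Lemma in_part_Y k f : in_part f ->
  in_part (tapp (cY k) f) /\ tapp (rY k) f = tapp (cY k) f.
Proof.
move=> [a ->]; rewrite !linear_sum /=.
have E lev c w : tapp (tY j0 lev c k) (a w *: tapp (pi w) epart) =
    a w *: tapp (pi w) (tapp (tY j0 lev c (w k)) epart).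
  by rewrite linearZ /= -!tappM tperm_Y.
split; last by apply: eq_bigr => w _; rewrite (E row_lev) (E comp_lev) rY_epart.
apply: in_part_sum => w _; rewrite E; apply/in_partZ/in_part_perm.
rewrite cY_epart -scaleN1r; apply: in_partD; first exact/in_partZ/in_part_epart.
apply/in_partZ/in_part_sum => y _; exact/in_part_perm/in_part_epart.
Qed.

(** Split the full column group into left cosets of the column group of the components; each coset
    gives a signed translate of [epart]. *)
Lemma in_part_efull : in_part efull.
Proof.
pose G := [set s | stab col s]; pose K := [set s | stab ccol s].
have Gg : group_set G.
  by apply/group_setP; split=> [|s p]; rewrite !inE ?stab1 //; apply: stabM.
have Kg : group_set K.
  by apply/group_setP; split=> [|s p]; rewrite !inE ?stab1 //; apply: stabM.
pose KK : {group 'S_d} := Group Kg; pose GG : {group 'S_d} := Group Gg.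
have KG : K \subset G.
  by apply/subsetP => s; rewrite !inE => hs; apply/stabP => a;
    rewrite (stab_ccolE a hs).2.
have asumE (Q : pred 'S_d) (f : tspace) :
    tapp (\sum_(s | Q s) (-1) ^+ s *: pi s) f =
      \sum_(s | Q s) (-1) ^+ s *: tapp (pi s) f.
  apply/ffunP => t; rewrite tapp_sum sum_ffunE; apply: eq_bigr => s _.
  by rewrite tappZ.
have epartE : epart = \sum_(s in K) (-1) ^+ s *: tapp (pi s) (delta F tab0).
  by rewrite /epart /asym asumE; apply: eq_bigl => s; rewrite inE.
rewrite /efull /asym asumE (eq_bigl (mem G)) => [|s];
  last by rewrite -[RHS]/(s \in G) inE.
rewrite (partition_big (fun s => s *: KK)%g (mem (lcosets KK G))) /=;
  last first.
  by move=> s sG; apply/lcosetsP; exists s.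
apply: in_part_sum => _ /lcosetsP[s sG ->].
rewrite (eq_bigl (mem (s *: KK)%g)) => [|p]; last first.
  rewrite -[RHS]/(p \in s *: KK)%g.
  apply/andP/idP => [[_ /eqP <-]|pK].
    exact: (lcoset_refl KK).
  split; last by rewrite (@lcoset_eqP _ KK _ _ pK).
  by case/lcosetP: pK => k kK ->; apply: (@groupM _ GG) => //;
    apply: (subsetP KG).
rewrite (reindex_inj (mulgI s)) /= (eq_bigl (mem K)) => [|p]; last first.
  by rewrite /= mem_lcoset mulKg.
rewrite (eq_bigr (fun p : 'S_d =>
  (-1) ^+ s *: tapp (pi s) ((-1) ^+ p *: tapp (pi p) (delta F tab0)))).
  rewrite -scaler_sumr -linear_sum -epartE.
  exact/in_partZ/in_part_perm/in_part_epart.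
move=> p _; rewrite linearZ /= scalerA -tappM -tperm_opM; congr (_ *: _).
by rewrite odd_permM signr_addb.
Qed.

(** * Comparison of the two Hecke modules *)

Section Representations.

Variables (H : degAffHecke F d) (rho rho' : {lrmorphism H -> tend}).
Hypothesis rhoX : forall k, rho (dah_poly H 'X_k) = rX k.
Hypothesis rhoT : forall w, rho (dah_perm H w) = pi w.
Hypothesis rho'X : forall k, rho' (dah_poly H 'X_k) = cX k.
Hypothesis rho'T : forall w, rho' (dah_perm H w) = pi w.

Lemma rhoC (r : {lrmorphism H -> tend}) c f : tapp (r (dah_poly H c%:MP)) f =
  c *: f.
Proof. by rewrite dah_polyC linearZ rmorph1 tappZ tapp1. Qed.

Lemma tLE k f : tapp (tL F j0 k) f =
  \sum_(y < d | (y < k)%N) tapp (pi (tperm y k)) f.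
Proof. by apply/ffunP => t; rewrite /tL tapp_sum sum_ffunE. Qed.

Lemma rho_in_part h f : in_part f ->
  in_part (tapp (rho' h) f) /\ tapp (rho h) f = tapp (rho' h) f.
Proof.
elim/(@dah_alg_ind _ _ H): h f => [c|k|w|z z' IH IH'|z z' IH IH'] f Nf.
- by rewrite !rhoC; split=> //; apply: in_partZ.
- rewrite rhoX rho'X /tX (tappD (rY k)) (tappD (cY k)) !tLE;
  have [NY ->] := in_part_Y k Nf; split=> //.
  by apply: in_partD => //; apply: in_part_sum => y _; apply: in_part_perm.
- by rewrite rhoT rho'T; split=> //; apply: in_part_perm.
- have [N1 E1] := IH _ Nf; have [N2 E2] := IH' _ Nf.
  by rewrite !rmorphD !tappD E1 E2; split=> //; apply: in_partD.
- have [N2 E2] := IH' _ Nf; have [N1 E1] := IH _ N2.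
  by rewrite !rmorphM !tappM E2.
Qed.

Lemma on_orbitP f : on_orbit f <-> forall t, (forall p,
  t <> tact tab0 p) -> f t = 0.
Proof.
split=> [h t tp|h t ft].
  by apply/eqP; apply: contraT => /h[p] /tp.
have [p /eqP|none] := pickP (fun p => t == tact tab0 p); first by exists p.
by case/eqP: ft; apply: h => p e; move: (none p); rewrite e eqxx.
Qed.

Lemma rho_on_orbit h f : on_orbit f -> on_orbit (tapp (rho' h) f).
Proof.
have act t (w : 'S_d) : (forall p, t <> tact tab0 p) -> forall p,
  tact t w <> tact tab0 p.
  move=> tp p /(congr1 (fun t => tact t w^-1)); rewrite !tactM mulVg tact1.
  exact: tp.
elim/(@dah_alg_ind _ _ H): h f => [c|k|w|z z' IH IH'|z z' IH IH'] f fo;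
  have /on_orbitP h := fo; apply/on_orbitP => t tp.
- by rewrite rhoC ffunE h //; exact: mulr0.
- rewrite rho'X /tX (tappDE (cY k)) tYE tLE sum_ffunE h // mulr0 sub0r !big1
  ?oppr0 ?addr0 //.
    by move=> y _; rewrite tperm_opE h //; apply: act.
  by move=> y _; rewrite h ?mulr0 //; apply: act.
- by rewrite rho'T tperm_opE h //; apply: act.
- have /on_orbitP h1 := IH _ fo; have /on_orbitP h2 := IH' _ fo.
  by rewrite rmorphD tappDE h1 // h2 // addr0.
- have /on_orbitP h1 := IH _ (IH' _ fo).
  by rewrite rmorphM tappM h1.
Qed.

Lemma delta_on_orbit : on_orbit (delta F tab0).
Proof.
move=> t; rewrite ffunE; case: (t =P tab0) => [-> _|_]; last by rewrite eqxx.
by exists 1%g; rewrite tact1.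
Qed.

Hypothesis box_order : forall a b : 'I_d, (a < b)%N =
  (row_lev (row a) < row_lev (row b))%N || (row a == row b) && (col a < col
    b)%N.

Definition box_weight a : F := row_wt (row a) + (col a)%:R.

(** The swaps with rows of lower level cancel against the Jucys-Murphy element. Its other
    transpositions stay in the row of [k], fix [tab0], and number [col k]. *)
Lemma rX_delta k : tapp (rX k) (delta F tab0) = box_weight k *: delta F tab0.
Proof.
pose below y := (row_lev (row y) < row_lev (row k))%N.
have YE : tapp (rY k) (delta F tab0) = row_wt (row k) *: delta F tab0 -
    \sum_(y | below y) delta F (tact tab0 (tperm k y)).
  apply/ffunP => t; rewrite tYE !ffunE sum_ffunE; congr (_ - _).
    by case: (t =P tab0) => [->|_]; rewrite ?tab0E // mulr0 scaler0.
  rewrite [RHS]big_mkcond; apply: eq_bigr => y _; rewrite !ffunE.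
  rewrite -(inj_eq (@tact_inj _ _ (tperm k y)) (tact t _)) tactM tperm2 tact1
    /below.
  case: (t =P _) => [->|_]; last by rewrite mulr0 if_same.
  by rewrite !tactE tpermL tpermR !tab0E mulr1; case: ifP.
rewrite /tX (tappD (rY k)) tLE YE [X in _ + X](bigID below) /=.
rewrite [X in _ + (X + _)](_ : _ =
  \sum_(y | below y) delta F (tact tab0 (tperm k y))); last first.
  apply: eq_big => [y|y _]; last by rewrite tperm_delta tpermC.
  by rewrite box_order -/(below y) andbC; case: (below y).
rewrite addrA subrK [X in _ + X](_ : _ =
  (col k)%:R *: delta F tab0) ?scalerDl //.
rewrite (eq_bigr (fun=> delta F tab0)) => [|y /andP[]]; last first.
  rewrite box_order tperm_delta => /orP[lt|/andP[/eqP e _] _];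
    first by rewrite /below lt.
  congr delta; apply/ffunP => x; rewrite tactE !tab0E.
  by case: tpermP => [->|->|//].
rewrite sumr_const scaler_nat; congr (_ *+ _).
rewrite -(cardsE (fun y : 'I_d => _)).
have -> : [set y : 'I_d | (y < k)%N && ~~ below y] =
    [set y | (row y == row k) && (col y < col k)%N].
  apply/setP => y; rewrite !inE box_order -/(below y).
  case: (boolP (below y)) => [by_|_] /=; rewrite ?andbT //.
  by move: by_; rewrite /below; case: eqP => //= ->; rewrite ltnn.
apply/eqP; rewrite eqn_leq card_col_ge ?card_col_le //=.
- move=> a b; rewrite !inE => /andP[/eqP ra _] /andP[/eqP rb _].
  by apply: box_inj; rewrite ra.
- by move=> a; rewrite inE => /andP[].
- move=> j jk; have [a [ra ca]] := box_ex (ltn_trans jk (col_lt k)).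
  by exists a; rewrite // inE ra eqxx ca.
Qed.

Lemma rho_poly_delta (p : {mpoly F[d]}) :
  tapp (rho (dah_poly H p)) (delta F tab0) = p.@[box_weight] *: delta F tab0.
Proof.
elim/mpoly_alg_ind: p => [c|k|p r IHp IHr|p r IHp IHr].
- by rewrite rhoC mevalC.
- by rewrite rhoX rX_delta mevalXU.
- by rewrite mevalD !rmorphD tappD IHp IHr scalerDl.
- by rewrite mevalM !rmorphM tappM IHr linearZ /= IHp scalerA mulrC.
Qed.

Definition full_elt : H := \sum_(s | stab col s) (-1) ^+ s *: dah_perm H s.

Lemma rho_full (r : {lrmorphism H -> tend}) :
  (forall w, r (dah_perm H w) = pi w) -> r full_elt = full.
Proof.
move=> rT; rewrite linear_sum; apply: eq_bigr => s _.
by rewrite linearZ /= rT.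
Qed.

(** Pass to [rho] by [rho_in_part], move the central [g] past the antisymmetriser, and evaluate it
    on the weight vector. *)
Lemma rho'_sym (g : {mpoly F[d]}) : g \is symmetric ->
  tapp (rho' (dah_poly H g)) efull = g.@[box_weight] *: efull.
Proof.
move=> gs; rewrite -(rho_in_part _ in_part_efull).2 /efull -{1}(rho_full rhoT)
  -tappM.
rewrite -rmorphM (dah_sym_central gs) rmorphM tappM rho_poly_delta linearZ /=.
by rewrite rho_full.
Qed.

(** Moving [h] past the antisymmetriser leaves the latter applied to a vector on the orbit, where
    its image is the line of [efull]. *)
Lemma rho'_commutes h : (forall y, rho' (h * y - y * h) = 0) ->
  exists a : F, tapp (rho' h) efull = a *: efull.
Proof.
move=> hC; have := hC full_elt;
  rewrite rmorphB !rmorphM /= (rho_full rho'T) => /eqP.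
rewrite subr_eq0 => /eqP e; rewrite /efull -tappM e tappM.
exact/full_on_orbit/rho_on_orbit/delta_on_orbit.
Qed.

(** The first variable is triangular for the component of the first entry: the factor of index [n]
    shrinks the support from components at most [n] to components below [n]. *)
Lemma cyclotomic_prod (k0 : 'I_d) n (hn : (n <= l)%N) f : k0 = 0 :> nat ->
  (forall t, (n <= (t k0).1)%N -> f t = 0) ->
  tapp (\prod_(r < n) (cX k0 - (q (widen_ord hn r))%:A)) f = 0.
Proof.
move=> k00; have tL0 g : tapp (tL F j0 k0) g = 0.
  by rewrite tLE big_pred0 // => y; rewrite k00.
elim: n hn f => [|n IHn] hn f f0.
  by rewrite big_ord0 tapp1; apply/ffunP => t; rewrite f0 // ffunE.
rewrite big_ord_recr tappM.
rewrite (eq_bigr (fun r => cX k0 - (q (widen_ord (ltnW hn) r))%:A)) => [|r _];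
  last first.
  have -> : widen_ord hn (widen_ord (leqnSn n) r) =
    widen_ord (ltnW hn) r by apply: val_inj.
  by [].
apply: IHn.
move=> t nt; rewrite tappDE tappNE tappZ tapp1 ffunE /tX (tappDE (cY k0)) tYE
  tL0.
rewrite !ffunE addr0 [X in _ - X - _]big1 ?subr0 => [|y _].
  rewrite /comp_wt; have [lt|gt|e] := ltngtP n (t k0).1; [|lia|].
  - by rewrite f0 // mulr0 scaler0 subrr.
  - apply/eqP; rewrite subr_eq0; apply/eqP; congr (q _ * _); apply: val_inj.
    by rewrite /= e.
rewrite /comp_lev; case: ltnP => [lt|_]; last by rewrite mul0r.
by rewrite f0 ?mulr0 // tactE tpermL; apply: leq_ltn_trans nt lt.
Qed.

End Representations.

End BoxTabloids.

Lemma rmorph_ideal0 (A B : pzRingType) (f : {rmorphism A -> B}) x y z :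
  f y = 0 -> f (x * y * z) = 0.
Proof. by rewrite !rmorphM => ->; rewrite mulr0 mul0r. Qed.

Lemma lex_key_lt (n x y a b : nat) : (a <= n)%N -> (b <= n)%N ->
  (x * n.+1 + a < y * n.+1 + b)%N = ((x < y) || ((x == y) && (a < b)))%N.
Proof.
move=> an bn; have [xy|xy|->] := ltngtP x y; last by rewrite ltn_add2l.
  by have := leq_mul xy (leqnn n.+1); rewrite mulSn /=; lia.
by have := leq_mul xy (leqnn n.+1); rewrite mulSn /=; lia.
Qed.

(** * The boxes of a multipartition *)

Section Boxes.

Variables (F : fieldType) (d l : nat) (q : l.-tuple F) (lam : multipartition l
  d).

Let J := ('I_l * 'I_d.+1)%type.

(** The default 0 makes the rows beyond the last part empty. *)
Definition row_len (x : J) : nat := nth 0%N (tnth lam x.1) x.2.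

Definition part_boxes (r : 'I_l) : seq (nat * nat) :=
  [seq (i, j) | i <- iota 0 (size (tnth lam r)),
    j <- iota 0 (nth 0%N (tnth lam r) i)].

Definition boxes : seq (J * nat) :=
  [seq ((r, inord p.1), p.2) | r <- enum 'I_l, p <- part_boxes r].

Lemma part_size_le (r : 'I_l) : (size (tnth lam r) <= d)%N.
Proof.
apply: (@leq_trans (sumn (tnth lam r))); last first.
  by rewrite -[leqRHS](mpart_size lam) (bigD1 r) //= leq_addr.
have /andP[_] := mpart_part lam r; elim: (tnth lam r) => //= k s IHs.
by rewrite inE negb_or => /andP[k0 /IHs]; case: k k0 => // k _; lia.
Qed.

Lemma row_len_le (r : 'I_l) (i i' : 'I_d.+1) : (i <= i')%N ->
  (row_len (r, i') <= row_len (r, i))%N.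
Proof.
move=> ii'; rewrite /row_len /=; have [lt|ge] := ltnP i' (size (tnth lam r)).
  have /andP[srt _] := mpart_part lam r.
  have gt : transitive geq by move=> x y z /= xy yz; apply: leq_trans yz xy.
  have gr : reflexive geq by move=> x /=.
  have lt' : (i < size (tnth lam r))%N := leq_ltn_trans ii' lt.
  exact: (sorted_leq_nth gt gr 0%N srt i i' lt' lt ii').
by rewrite nth_default.
Qed.

Lemma mem_part_boxes r p : (p \in part_boxes r) =
  (p.2 < nth 0%N (tnth lam r) p.1)%N.
Proof.
case: p => [i j]; apply/allpairsPdep/idP => [[i' [j' [_ jl [-> ->]]]]|/= jl].
  by move: jl; rewrite mem_iota.
exists i, j; rewrite !mem_iota !add0n jl; split=> //.
by rewrite /= ltnNge; apply/negP => il; move: jl; rewrite nth_default.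
Qed.

Lemma part_boxes_le r p : p \in part_boxes r -> (p.1 <= d)%N.
Proof.
rewrite mem_part_boxes; have [//|dp] := leqP p.1 d.
by rewrite nth_default // (leq_trans (part_size_le r)) // ltnW.
Qed.

Lemma mem_boxes (b : J * nat) : (b \in boxes) = (b.2 < row_len b.1)%N.
Proof.
case: b => [[r i] j] /=;
  apply/allpairsPdep/idP => [[r' [p [_ pr [-> -> ->]]]]|jl].
  by rewrite /row_len /= inordK ?ltnS ?(part_boxes_le pr) // -mem_part_boxes.
exists r, (val i, j); rewrite mem_enum mem_part_boxes /=; split=> //.
by rewrite inord_val.
Qed.

Definition box_residue (b : J * nat) : F := q`_(b.1.1) + b.2%:R - (b.1.2)%:R.

Lemma mresiduesE : mresidues q lam =
  map box_residue boxes.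
Proof.
rewrite map_flatten -map_comp; congr flatten; apply: eq_map => r /=.
rewrite -map_comp /residues /part_boxes map_flatten -map_comp; congr flatten.
apply/eq_in_map => i; rewrite mem_iota /= add0n => ir.
rewrite -map_comp; apply: eq_map => j;
  rewrite /box_residue /= inordK ?(tnth_nth 0) //.
by rewrite ltnS (leq_trans (ltnW ir)) // part_size_le.
Qed.

Lemma boxes_uniq : uniq boxes.
Proof.
apply: allpairs_uniq_dep => [|r _|]; first exact: enum_uniq.
  apply: allpairs_uniq_dep => [|i _|]; rewrite ?iota_uniq //.
  by case=> [i j] [i' j'] _ _ [-> ->].
case=> [r p] [r' p'] /allpairsPdep[x [y [_ xy e]]] /allpairsPdep[x' [y' [_ xy'
  e']]] /=.
case=> rr ii jj; rewrite -rr in e' *; congr Tagged.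
have pr : p \in part_boxes r by case: e xy => -> ->.
have pr' : p' \in part_boxes r by case: e' xy' => -> ->.
case: p p' ii jj pr pr' {e e'} =>
  [i j] [i' j'] /= ii -> /part_boxes_le /= il /part_boxes_le /= il'.
by move/(congr1 val): ii; rewrite /= !inordK // => ->.
Qed.

Lemma size_boxes : size boxes = d.
Proof.
rewrite size_allpairs_dep sumnE big_map big_enum /= -[RHS](mpart_size lam).
apply: eq_bigr => r _;
  rewrite size_allpairs_dep (eq_map (fun i => size_iota 0 _)).
by rewrite -/(mkseq _ _) mkseq_nth.
Qed.

(** Encodes the lexicographic order by level and column, as columns are at most [d]; sorting by it
    numbers the entries so that [tab0] is a weight vector. *)
Definition box_key (b : J * nat) : nat := (row_lev b.1 * d.+1 + b.2)%N.

Lemma row_len_le_d x : (row_len x <= d)%N.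
Proof.
have := mpart_size lam; rewrite (bigD1 x.1) //= => dE.
apply: (@leq_trans (sumn (tnth lam x.1))); last by rewrite -[leqRHS]dE leq_addr.
rewrite /row_len; elim: (tnth lam x.1) (val x.2) => [|k s IHs] [|n] //=.
  exact: leq_addr.
exact: leq_trans (IHs n) (leq_addl _ _).
Qed.

Lemma box_key_lt b b' : b \in boxes -> b' \in boxes ->
  (box_key b < box_key b')%N = ((row_lev b.1 < row_lev b'.1)
    || ((b.1 == b'.1) && (b.2 < b'.2)))%N.
Proof.
rewrite !mem_boxes => /leq_trans/(_ (row_len_le_d _)) bd.
move=> /leq_trans/(_ (row_len_le_d _)) bd'; rewrite /box_key.
rewrite -(inj_eq (@row_lev_inj _ _)).
by apply: lex_key_lt; apply: ltnW.
Qed.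

Lemma box_key_inj : {in boxes &, injective box_key}.
Proof.
move=> b b' bb bb' e; have := box_key_lt bb bb'; have := box_key_lt bb' bb.
rewrite e ltnn => /esym/norP[lt1 lt2] /esym/norP[lt3 lt4].
have rr : b.1 = b'.1.
  apply: (@row_lev_inj l d.+1); move: lt1 lt3; rewrite -!leqNgt => h h'.
  by apply/eqP; rewrite eqn_leq h h'.
move: lt2 lt4; rewrite rr eqxx /= -!leqNgt => h h'.
by rewrite [b]surjective_pairing rr [b']surjective_pairing; congr pair;
  apply/eqP;
  rewrite eqn_leq h h'.
Qed.

Definition sorted_boxes : seq (J * nat) :=
  sort (fun b b' => box_key b <= box_key b')%N boxes.

Lemma mem_sorted_boxes b : (b \in sorted_boxes) = (b \in boxes).
Proof. by rewrite mem_sort. Qed.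

Lemma size_sorted_boxes : size sorted_boxes = d.
Proof. by rewrite size_sort size_boxes. Qed.

Variable j0 : J.

Definition box_at (a : 'I_d) : J * nat := nth (j0, 0%N) sorted_boxes a.

Lemma box_at_mem a : box_at a \in boxes.
Proof. by rewrite -mem_sorted_boxes mem_nth // size_sorted_boxes. Qed.

Lemma box_at_inj : injective box_at.
Proof.
move=> a b /eqP; rewrite nth_uniq ?size_sorted_boxes ?sort_uniq ?boxes_uniq //.
by move/eqP/val_inj.
Qed.

Lemma box_at_key (a b : 'I_d) : (a < b)%N =
  (box_key (box_at a) < box_key (box_at b))%N.
Proof.
have tot : total (fun b b' : J * nat => box_key b <= box_key b')%N.
  by move=> x y; apply: leq_total.
have tr : transitive (fun b b' : J * nat => box_key b <= box_key b')%N.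
  by move=> x y z; apply: leq_trans.
have rf : reflexive (fun b b' : J * nat =>
  box_key b <= box_key b')%N by move=> x /=.
have le (x y : 'I_d) : (x <= y)%N -> (box_key (box_at x) <= box_key (box_at
  y))%N.
  have sz (z : 'I_d) : (z < size sorted_boxes)%N by rewrite size_sorted_boxes.
  move=> xy; exact: (sorted_leq_nth tr rf (j0,
    0%N) (sort_sorted tot boxes) x y (sz x) (sz y) xy).
apply/idP/idP => [lt|]; last by apply: contraTT; rewrite -!leqNgt; apply: le.
rewrite ltn_neqAle (le a b (ltnW lt)) andbT; apply/eqP => e; move: lt.
by rewrite (box_at_inj (box_key_inj (box_at_mem a) (box_at_mem b) e)) ltnn.
Qed.

Lemma box_at_weights :
  perm_eq [seq box_residue (box_at a) | a <- enum 'I_d]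
          (mresidues q lam).
Proof.
rewrite mresiduesE (map_comp box_residue box_at); apply: perm_map;
  apply: uniq_perm.
- by rewrite map_inj_uniq ?enum_uniq //; apply: box_at_inj.
- exact: boxes_uniq.
move=> b; apply/mapP/idP => [[a _ ->]|bb]; first exact: box_at_mem.
have lt : (index b sorted_boxes < d)%N.
  by rewrite -[X in (_ < X)%N]size_sorted_boxes index_mem mem_sorted_boxes.
by exists (Ordinal lt);
  rewrite ?mem_enum // /box_at nth_index // mem_sorted_boxes.
Qed.

End Boxes.

(** * From a multipartition to a factoring character *)

Lemma residues_factor (F : fieldType) (d l : nat) (hd : (0 < d)%N) (hl : (0 <
  l)%N)
    (q : l.-tuple F) (H : degAffHecke F d) (Hq : cyclotomicQuotient H hd q)
    (lam : multipartition l d) (i : d.-tuple F) :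
  perm_eq i (mresidues q lam) -> chi_factors Hq i.
Proof.
move=> ilam; pose j0 : 'I_l * 'I_d.+1 := (Ordinal hl, ord0).
pose row a := (box_at lam j0 a).1; pose col a := (box_at lam j0 a).2.
pose qf (r : 'I_l) := q`_r.
have box_inj a b : row a = row b -> col a = col b -> a = b.
  move=> r c; apply: (@box_at_inj _ _ lam j0); move: r c; rewrite /row /col.
  by case: (box_at _ _ a) (box_at _ _ b) => [? ?] [? ?] /= -> ->.
have len_le := @row_len_le d l lam.
have col_lt a : (col a < row_len lam (row a))%N by rewrite -mem_boxes
  box_at_mem.
have box_ex x j : (j < row_len lam x)%N -> exists a, row a = x /\ col a = j.
  move=> jx; have bb : (x, j) \in boxes lam by rewrite mem_boxes.
  have lt : (index (x, j) (sorted_boxes lam) < d)%N.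
    by rewrite -[X in (_ < X)%N](size_sorted_boxes lam) index_mem
      mem_sorted_boxes.
  exists (Ordinal lt).
  by rewrite /row /col /box_at nth_index ?mem_sorted_boxes.
have box_order (a b : 'I_d) : (a < b)%N = (row_lev (row a) < row_lev (row b))%N
    || (row a == row b) && (col a < col b)%N.
  by rewrite (box_at_key lam j0) (@box_key_lt _ _ lam) ?box_at_mem.
have [rho [rhoX rhoT]] := @tabloid_module F d _ j0 _ _ (@row_lev_wt F l d.+1
  qf) H.
have [rho' [rho'X rho'T]] := @tabloid_module F d _ j0 _ _ (@comp_lev_wt F l
  d.+1 qf) H.
pose e := efull F j0 row col.
pose k0 := Ordinal hd.
have ker h : cq_proj Hq h = 0 -> rho' h = 0.
  move=> /cq_proj_ker[s ->]; rewrite rmorph_sum big1 // => p _.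
  apply: rmorph_ideal0.
  apply: tappP => f t; rewrite tapp0 !rmorph_prod /=.
  have cE : \prod_(r < l) rho' (dah_poly H ('X_k0 - (tnth q r)%:MP)) =
      \prod_(r < l) (tX j0 (@comp_lev l d.+1) (comp_wt qf) k0 -
                     (qf (widen_ord (leqnn l) r))%:A).
    apply: eq_bigr => r _; rewrite !rmorphB /= rho'X dah_polyC linearZ rmorph1.
    by rewrite (tnth_nth 0).
  rewrite cE cyclotomic_prod // => t'.
  by rewrite leqNgt ltn_ord.
have ex (y : Hq) : exists z, cq_proj Hq z == y.
  by have [z <-] := cq_proj_surj y; exists z.
pose lift y := xchoose (ex y).
have liftK y : cq_proj Hq (lift y) = y by apply/eqP/(xchooseP (ex y)).
have rho_eq h h' : cq_proj Hq h = cq_proj Hq h' -> rho' h = rho' h'.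
  move=> hh; have := ker (h - h'); rewrite !rmorphB hh subrr => /(_ erefl)/eqP.
  by rewrite subr_eq0 => /eqP.
(* Since [efull] has value 1 at [tab0], this is the scalar by which a central [y] acts on it;
   [rho_eq] makes it independent of the lift. *)
pose phi y : F := tapp (rho' (lift y)) e (tab0 row).
have e1 : e (tab0 row) = 1 by apply: efull_tab0.
have phiE y : central y -> tapp (rho' (lift y)) e = phi y *: e.
  move=> yC.
  have [|a aE] := rho'_commutes col_lt box_ex rho'X rho'T (h := lift y).
    move=> z; apply: ker; rewrite rmorphB !rmorphM !liftK yC subrr //.
  by rewrite /phi aE ffunE e1; congr (_ *: _); rewrite -[LHS]mulr1.
exists phi.
  split.
  - by rewrite /phi (rho_eq _ 1) ?rmorph1 ?tapp1 ?liftK.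
  - move=> y z _ _; rewrite /phi (rho_eq _ (lift y + lift z)) ?rmorphD ?tappDE
    //.
    by rewrite !liftK.
  - move=> y z yC zC; rewrite {1}/phi (rho_eq _ (lift y * lift z)) ?rmorphM
    ?liftK //.
    rewrite tappM phiE // linearZ /= phiE // !ffunE e1.
    by transitivity (phi z * (phi y * 1)); rewrite // mulr1 mulrC.
  - move=> a z _; rewrite /phi (rho_eq _ (a *: lift z)).
      by rewrite linearZ tappZ ffunE.
    by rewrite -[a *: lift z]mulr_algl rmorphM !liftK.
move=> z /dah_centralP[g gs ->]; exists g => //; split=> //.
rewrite /phi (rho_eq _ (dah_poly H g)) ?liftK //.
rewrite (rho'_sym box_inj len_le col_lt box_ex rhoX rhoT rho'X rho'T box_order
  gs).
rewrite ffunE e1; transitivity (g.@[box_weight qf row col] * 1) => //.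
pose W := [tuple box_weight qf row col a | a < d].
have iW : perm_eq i W.
  apply: perm_trans ilam _; rewrite perm_sym;
    apply: perm_trans (box_at_weights q lam j0).
  apply/seq.permP => P; congr (count P); apply: eq_map => a.
  exact: addrAC.
rewrite mulr1 (meval_perm_eq iW gs); apply: meval_eq => a.
by rewrite tnth_mktuple.
Qed.

Theorem lemma4p2 (F : fieldType) (d l : nat) (hd : (0 < d)%N) (hl : (0 < l)%N)
    (q : l.-tuple F) (H : degAffHecke F d) (Hq : cyclotomicQuotient H hd q) :
  forall c : Xd F d,
    Xdq Hq c <-> exists lam : multipartition l d, c = residue_class q lam.
Proof.
move=> c; split=> [[phi phi_hom phi_chi]|[lam cE]].
  have [lam ilam] := factor_residues phi_hom phi_chi; exists lam.
  by rewrite -[LHS]reprK; apply/eqP; rewrite eqmodE.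
suff ilam : perm_eq (generic_quotient.repr c) (mresidues q lam).
  exact: (residues_factor hl Hq ilam).
have : (\pi_(Xd F d) (generic_quotient.repr c) =
  residue_class q lam)%qT by rewrite reprK.
by move/eqP; rewrite eqmodE.
Qed.
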